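(* Let $(V_\ell)_{\ell\in\mathbb N}$ be the neural network spaces, $(S_{h(\ell)})_{\ell\in\mathbb N}$ the associated finite element spaces with zero boundary values, $I_{S_{h(\ell)}}$ the corresponding Lagrange interpolants, and $$\mathcal E_\ell(v)=\int_\Omega\Big(\tfrac12|\nabla I_{S_{h(\ell)}}(v)|^2-I_{S_{h(\ell)}}(f\,v)\Big)\,dx,\qquad v\in V_\ell,$$ where $f\in C^0(\bar\Omega)$. The functional $\mathcal E_\ell$ is stable with respect to the $H^1$-norm in the following sense: let $(v_\ell)$ be a sequence of functions with $v_\ell\in V_\ell$ such that, for a constant $C>0$ independent of $\ell$, $$\mathcal E_\ell(v_\ell)\le C\quad\text{for all }\ell .$$ Then there exists a constant $C_1>0$, independent of $\ell$, such that $$\|I_{S_{h(\ell)}}v_\ell\|_{H^1(\Omega)}\le C_1\quad\text{for all }\ell .$$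
   Context: Domain: $\Omega\subset\mathbb R^d$, $1\le d\le 3$, is a bounded polygonal domain (an interval if $d=1$, polyhedral if $d=3$). Neural network spaces: for a fixed number of layers $L$, fixed widths $d_1=d,d_2,\dots,d_{L+1}=1$ and a continuous activation function $\sigma:\mathbb R\to\mathbb R$ (applied componentwise), $V_{\mathcal N}$ is the set of all functions $u_\theta:\Omega\to\mathbb R$ (extended continuously to $\bar\Omega$) of the form $u_\theta=C_L\circ\sigma\circ C_{L-1}\circ\cdots\circ\sigma\circ C_1$ with affine maps $C_ky=W_ky+b_k$, $W_k\in\mathbb R^{d_{k+1}\times d_k}$, $b_k\in\mathbb R^{d_{k+1}}$. For each $\ell\in\mathbb N$, $V_\ell\subset C^0(\bar\Omega)$ is one such space (with architecture depending on $\ell$); it is in general not a linear space and its elements need not vanish on $\partial\Omega$. The architecture plays no further role in the statement. Finite element spaces: for each $\ell$, $T_{h(\ell)}$ is a conforming simplicial triangulation of $\bar\Omega$ of maximal element diameter $h(\ell)$, with $h(\ell)\to0$ as $\ell\to\infty$; the family $(T_{h(\ell)})_\ell$ is shape regular, uniformly in $\ell$. For a fixed polynomial degree $q\ge1$, $$S_{h(\ell)}=\{v\in C^0(\bar\Omega):\ v|_K\in\mathbb P_q(K)\ \ \forall K\in T_{h(\ell)},\ v=0\text{ on }\partial\Omega\},$$ where $\mathbb P_q(K)$ denotes the polynomials of degree at most $q$ on $K$. Let $\mathcal Z_\ell$ be the set of Lagrange nodes (degrees of freedom) of $S_{h(\ell)}$, i.e. the nodes not lying on $\partial\Omega$, and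 $\{\Phi_z\}_{z\in\mathcal Z_\ell}$ the corresponding Lagrangian nodal basis. The interpolant $I_{S_{h(\ell)}}:C^0(\bar\Omega)\to S_{h(\ell)}$ is $I_{S_{h(\ell)}}u=\sum_{z\in\mathcal Z_\ell}u(z)\Phi_z$ (so values of $u$ at boundary nodes are replaced by zero). *)

(* Defs.v *)
From HB Require Import structures.
From mathcomp Require Import all_boot all_order all_algebra.
From mathcomp Require Import finmap.
From mathcomp Require Import all_classical all_reals all_analysis.

Set Implicit Arguments.
Unset Strict Implicit.
Unset Printing Implicit Defensive.

Import Order.TTheory GRing.Theory Num.Theory numFieldNormedType.Exports.

Local Open Scope classical_set_scope.
Local Open Scope ring_scope.

(* R^d is 'rV[R]_d, with the product sigma-algebra (generated by the
   coordinates), which coincides with the Borel sigma-algebra. *)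

Definition rV_display : measure_display.
Proof. exact: (measure_tuple_display default_measure_display). Qed.

Section measurable_rV.
Context {R : realType}.
Variable n : nat.

Definition rV_coord (i : 'I_n) (x : 'rV[R]_n) : measurableTypeR R := x 0 i.

Let rV_set0 : g_sigma_preimage rV_coord set0.
Proof. exact: sigma_algebra0. Qed.

Let rV_setC A : g_sigma_preimage rV_coord A -> g_sigma_preimage rV_coord (~` A).
Proof. exact: sigma_algebraC. Qed.

Let rV_bigcup (F : (set 'rV[R]_n)^nat) :
  (forall i, g_sigma_preimage rV_coord (F i)) ->
  g_sigma_preimage rV_coord (\bigcup_i (F i)).
Proof. exact: sigma_algebra_bigcup. Qed.

HB.instance Definition _ := @isMeasurable.Build rV_display 'rV[R]_n
  (g_sigma_preimage rV_coord) rV_set0 rV_setC rV_bigcup.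

Lemma measurable_rV_coord (i : 'I_n) :
  measurable_fun [set: 'rV[R]_n] (rV_coord i).
Proof.
move=> _ Y mY; rewrite setTI; apply: sub_sigma_algebra => /=.
rewrite -bigcup_seq/=; exists i => /=; first by rewrite mem_index_enum.
by exists Y => //; rewrite setTI.
Qed.

Lemma measurable_fun_rV d (T : measurableType d) (f : T -> 'rV[R]_n) :
  (forall i, measurable_fun [set: T] (rV_coord i \o f)) ->
  measurable_fun [set: T] f.
Proof.
move=> mf _ A mA.
have : g_sigma_preimage (fun i => rV_coord i \o f) `<=` @measurable _ T.
  apply: smallest_sub; first exact: sigma_algebra_measurable.
  rewrite -bigcup_seq; apply: bigcup_sub => i _ B [C mC <-].
  exact: mf.
by rewrite g_sigma_preimage_comp; apply; exists A.
Qed.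

End measurable_rV.

Lemma product_sigma_finite d1 d2 (T1 : measurableType d1)
    (T2 : measurableType d2) (R : realType)
    (m1 : {sigma_finite_measure set T1 -> \bar R})
    (m2 : {sigma_finite_measure set T2 -> \bar R}) :
  sigma_finite setT (m1 \x m2)%E.
Proof.
have /sigma_finiteP[F [TF ndF Foo]] := sigma_finiteT m1.
have /sigma_finiteP[G [TG ndG Goo]] := sigma_finiteT m2.
exists (fun n => F n `*` G n).
  rewrite -setXTT TF TG predeqE => -[x y]; split.
    move=> [/= [n _ Fnx] [k _ Gky]]; exists (maxn n k) => //; split.
    - by move: x Fnx; exact/subsetPset/ndF/leq_maxl.
    - by move: y Gky; exact/subsetPset/ndG/leq_maxr.
  by move=> [n _ []/= ? ?]; split; exists n.
move=> k; have [? ?] := Foo k; have [? ?] := Goo k.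
split; first exact: measurableX.
by rewrite product_measure1E// lte_mul_pinfty// ge0_fin_numE.
Qed.

Section lebesgue_rV.
Context {R : realType}.

Definition cons_rV n (xy : measurableTypeR R * 'rV[R]_n) : 'rV[R]_n.+1 :=
  row_mx (const_mx xy.1 : 'rV_1) xy.2.

Definition uncons_rV n (z : 'rV[R]_n.+1) : measurableTypeR R * 'rV[R]_n :=
  (z 0 0, @rsubmx _ 1 1 n z).

Lemma cons_rVK n : cancel (@cons_rV n) (@uncons_rV n).
Proof.
move=> [x y]; rewrite /cons_rV /uncons_rV row_mxKr /=; congr pair.
transitivity (row_mx (const_mx x : 'rV[R]_1) y 0 (lshift n 0)).
  by congr (row_mx _ _ _ _); exact: ord_inj.
by rewrite row_mxEl mxE.
Qed.

Lemma measurable_cons_rV n : measurable_fun [set: _] (@cons_rV n).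
Proof.
apply: measurable_fun_rV => i.
case: (split_ordP (i : 'I_(1 + n))) => j ij.
  rewrite (_ : _ \o _ = fst); first exact: measurable_fst.
  apply/funext => -[x y]; rewrite /= /rV_coord ij.
  by rewrite -[LHS]/(row_mx (const_mx x : 'rV[R]_1) y 0 (lshift n j)) row_mxEl mxE.
rewrite (_ : _ \o _ = rV_coord j \o snd).
  by apply: measurableT_comp; [exact: measurable_rV_coord|exact: measurable_snd].
apply/funext => -[x y]; rewrite /= /rV_coord ij.
by rewrite -[LHS]/(row_mx (const_mx x : 'rV[R]_1) y 0 (rshift 1 j)) row_mxEr.
Qed.

Lemma measurable_uncons_rV n : measurable_fun [set: _] (@uncons_rV n).
Proof.
apply: measurable_fun_pair; first exact: measurable_rV_coord.
apply: measurable_fun_rV => i.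
rewrite (_ : _ \o _ = rV_coord (rshift 1 i)); first exact: measurable_rV_coord.
by apply/funext => z; rewrite /= /rV_coord mxE.
Qed.

Section step.
Variables (n : nat) (m : {sigma_finite_measure set 'rV[R]_n -> \bar R}).

Definition lebesgue_rVS : set 'rV[R]_n.+1 -> \bar R :=
  pushforward (lebesgue_measure \x m)%E (@cons_rV n).

Let lebesgue_rVS0 : lebesgue_rVS set0 = 0%E.
Proof. by rewrite /lebesgue_rVS /pushforward preimage_set0 measure0. Qed.

Let lebesgue_rVS_ge0 A : (0 <= lebesgue_rVS A)%E.
Proof. by rewrite /lebesgue_rVS /pushforward; exact: measure_ge0. Qed.

Let lebesgue_rVS_additive : semi_sigma_additive lebesgue_rVS.
Proof.
have mC A : measurable A -> measurable (@cons_rV n @^-1` A).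
  by move=> mA; rewrite -[X in measurable X]setTI; exact: measurable_cons_rV.
move=> F mF tF mUF; rewrite /lebesgue_rVS /pushforward preimage_bigcup.
apply: measure_semi_sigma_additive.
- by move=> k; exact: mC.
- apply/trivIsetP => /= i j _ _ ij; rewrite -preimage_setI.
  by move/trivIsetP : tF => /(_ _ _ _ _ ij) ->//; rewrite preimage_set0.
- by rewrite -preimage_bigcup; exact: mC.
Qed.

HB.instance Definition _ := isMeasure.Build _ _ _ lebesgue_rVS
  lebesgue_rVS0 lebesgue_rVS_ge0 lebesgue_rVS_additive.

Let lebesgue_rVS_sigma_finite : sigma_finite setT lebesgue_rVS.
Proof.
have [F FT Foo] : sigma_finite setT (lebesgue_measure \x m)%E.
  exact: product_sigma_finite.
exists (fun k => @uncons_rV n @^-1` F k).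
  by rewrite -preimage_bigcup -FT preimage_setT.
move=> k; have [mF Fk] := Foo k; split.
  by rewrite -[X in measurable X]setTI; exact: measurable_uncons_rV.
rewrite /lebesgue_rVS /pushforward -comp_preimage.
by rewrite (_ : _ \o _ = id) //; apply/funext => z; exact: cons_rVK.
Qed.

HB.instance Definition _ := @Measure_isSigmaFinite.Build _ _ _ lebesgue_rVS
  lebesgue_rVS_sigma_finite.

End step.

(* d-dimensional Lebesgue measure: the unit mass on R^0, and
   lambda_(n+1) is lambda_1 x lambda_n read through R x R^n = R^(n+1). *)
Fixpoint lebesgue_rV (n : nat) : {sigma_finite_measure set 'rV[R]_n -> \bar R} :=
  match n with
  | 0 => dirac (0 : 'rV[R]_0)
  | n'.+1 => lebesgue_rVS (lebesgue_rV n')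
  end.

End lebesgue_rV.

Section euclidean_space.
Context {R : realType} {d : nat}.
Implicit Types (A : set 'rV[R]_d) (x : 'rV[R]_d).

(* The norm `|x| of 'rV[R]_d is the maximum norm. *)
Definition enorm x : R := Num.sqrt (\sum_(i < d) x 0 i ^+ 2).

Definition diameter A : R :=
  sup [set r | exists x y, [/\ A x, A y & r = enorm (x - y)]].

(* Diameter of the largest ball contained in A. *)
Definition inball_diameter A : R :=
  sup [set r | 0 <= r /\ exists c, [set x | enorm (x - c) <= r / 2] `<=` A].

Definition boundary A : set 'rV[R]_d := closure A `\` interior A.

End euclidean_space.

Section triangulations.
Context {R : realType} {d : nat}.

Definition simplex := {ffun 'I_d.+1 -> 'rV[R]_d}.

Definition nondegenerate (K : simplex) : bool :=
  (\matrix_(i < d) (K (lift ord0 i) - K ord0)) \in unitmx.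

(* The face of K spanned by the vertices with index in I (empty if I is). *)
Definition face (K : simplex) (I : {set 'I_d.+1}) : set 'rV[R]_d :=
  [set x | exists lam : 'I_d.+1 -> R,
    [/\ forall i, 0 <= lam i, forall i, i \notin I -> lam i = 0,
        \sum_i lam i = 1 & x = \sum_i lam i *: K i]].

Definition hull (K : simplex) : set 'rV[R]_d := face K [set: 'I_d.+1]%SET.

Definition carrier (T : {fset simplex}) : set 'rV[R]_d :=
  [set x | exists2 K, K \in T & hull K x].

Definition conforming (T : {fset simplex}) : Prop :=
  forall K K', K \in T -> K' \in T -> exists I J : {set 'I_d.+1},
    hull K `&` hull K' = face K I /\ face K I = face K' J.

Definition triangulation (Omega : set 'rV[R]_d) (T : {fset simplex}) : Prop :=
  [/\ forall K, K \in T -> nondegenerate K, conforming T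
    & carrier T = closure Omega].

Definition mesh_size (T : {fset simplex}) : R :=
  \big[Num.max/0]_(K <- T) diameter (hull K).

Definition shape_regular (T : nat -> {fset simplex}) : Prop :=
  exists2 gamma : R, 0 < gamma & forall l K, K \in T l ->
    diameter (hull K) <= gamma * inball_diameter (hull K).

(* A bounded domain which is the interior of a finite union of simplices; no
   Lipschitz condition is imposed on the boundary. For d = 1 these are the
   bounded open intervals. *)
Definition polygonal_domain (Omega : set 'rV[R]_d) : Prop :=
  [/\ Omega !=set0, connected Omega, bounded_set Omega &
      exists T : {fset simplex}, (forall K, K \in T -> nondegenerate K) /\
        Omega = interior (carrier T)].

End triangulations.
Arguments simplex : clear implicits.

Section finite_elements.
Context {R : realType} {d : nat}.
Variables (Omega : set 'rV[R]_d) (T : {fset simplex R d}) (q : nat).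

Definition polynomial_fun (p : 'rV[R]_d -> R) : Prop :=
  exists c : {ffun 'I_d -> 'I_q.+1} -> R, forall x,
    p x = \sum_(a : {ffun 'I_d -> 'I_q.+1} | (\sum_i a i <= q)%N)
      c a * \prod_i x 0 i ^+ a i.

(* A function on the closure of Omega is represented by a function on R^d whose
   values outside the closure are irrelevant. *)
Definition fe_space : set ('rV[R]_d -> R) :=
  [set v | [/\ {within closure Omega, continuous v},
    forall K, K \in T -> exists2 p, polynomial_fun p &
      forall x, hull K x -> v x = p x
    & forall x, boundary Omega x -> v x = 0]].

(* Principal lattice points of the simplices that do not lie on the boundary. *)
Definition lagrange_nodes : set 'rV[R]_d :=
  [set z | ~ boundary Omega z /\ exists2 K, K \in T &
    exists a : 'I_d.+1 -> nat, (\sum_i a i)%N = q /\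
      z = \sum_i ((a i)%:R / q%:R) *: K i].

(* Phi_z: the finite element function equal to 1 at the node z and to 0 at all
   other nodes, which is uniquely determined on the closure of Omega. *)
Definition nodal_basis (z : 'rV[R]_d) : 'rV[R]_d -> R :=
  get [set phi | fe_space phi /\
    forall z', lagrange_nodes z' -> phi z' = (z' == z)%:R].

Definition interpolant (u : 'rV[R]_d -> R) : 'rV[R]_d -> R :=
  fun x => \sum_(z \in lagrange_nodes) u z * nodal_basis z x.

End finite_elements.

Section sobolev.
Context {R : realType} {d : nat}.
Variable Omega : set 'rV[R]_d.
Implicit Types (u phi : 'rV[R]_d -> R) (g : 'rV[R]_d -> 'rV[R]_d).

Definition partial (i : 'I_d) u : 'rV[R]_d -> R :=
  fun x => 'D_(delta_mx 0 i) u x.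

Definition partials (s : seq 'I_d) u : 'rV[R]_d -> R := foldr partial u s.

Definition smooth u : Prop :=
  forall s : seq 'I_d, continuous (partials s u) /\
    forall i x, derivable (partials s u) x (delta_mx 0 i).

Definition test_function phi : Prop :=
  smooth phi /\ exists A, [/\ compact A, A `<=` Omega
    & forall x, ~ A x -> phi x = 0].

Definition square_integrable u : Prop :=
  measurable_fun Omega u /\
  (\int[lebesgue_rV d]_(x in Omega) (u x ^+ 2)%:E < +oo)%E.

(* u is in H^1(Omega) and g represents its weak gradient. *)
Definition is_weak_gradient u g : Prop :=
  [/\ square_integrable u,
      forall i, square_integrable (fun x => g x 0 i)
    & forall i phi, test_function phi ->
        (\int[lebesgue_rV d]_(x in Omega) (u x * partial i phi x)%:E =
         - \int[lebesgue_rV d]_(x in Omega) (g x 0 i * phi x)%:E)%E].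

(* The choice is immaterial: weak gradients are unique almost everywhere. *)
Definition weak_gradient u : 'rV[R]_d -> 'rV[R]_d :=
  get (is_weak_gradient u).

Definition H1norm u : \bar R :=
  if `[< exists g, is_weak_gradient u g >] then
    ((\int[lebesgue_rV d]_(x in Omega)
       (u x ^+ 2 + enorm (weak_gradient u x) ^+ 2)%:E) `^ 2^-1)%E
  else +oo%E.

End sobolev.

Section energy.
Context {R : realType} {d : nat}.
Variables (Omega : set 'rV[R]_d) (T : {fset simplex R d}) (q : nat).
Variable f : 'rV[R]_d -> R.

Definition energy (v : 'rV[R]_d -> R) : \bar R :=
  (\int[lebesgue_rV d]_(x in Omega)
    (2^-1 * enorm (weak_gradient Omega (interpolant Omega T q v) x) ^+ 2
     - interpolant Omega T q (f \* v) x)%:E)%E.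

End energy.

Section neural_networks.
Context {R : realType}.

(* Parameters of a network with input width m and hidden widths ws (the output
   width is 1): the pairs (W_k, b_k), from the first layer to the last. *)
Fixpoint nn_parameters (m : nat) (ws : seq nat) : Type :=
  match ws with
  | [::] => ('M[R]_(1, m) * 'rV[R]_1)%type
  | k :: ws' => (('M[R]_(k, m) * 'rV[R]_k) * nn_parameters k ws')%type
  end.

(* Vectors are rows, so that y |-> W y + b reads y *m W^T + b. *)
Fixpoint nn_realization (sigma : R -> R) (m : nat) (ws : seq nat) :
    nn_parameters m ws -> 'rV[R]_m -> R :=
  match ws return nn_parameters m ws -> 'rV[R]_m -> R with
  | [::] => fun theta y => (y *m theta.1^T + theta.2) 0 0
  | k :: ws' => fun theta y =>
      nn_realization sigma theta.2
        (map_mx sigma (y *m theta.1.1^T + theta.1.2))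
  end.

Record nn_architecture := NNArchitecture {
  hidden_widths : seq nat;
  hidden_widths_gt0 : all (leq 1) hidden_widths;
  activation : R -> R;
  activation_continuous : continuous activation }.

Definition nn_space (d : nat) (a : nn_architecture) (Omega : set 'rV[R]_d) :
    set ('rV[R]_d -> R) :=
  [set v | exists theta : nn_parameters d (hidden_widths a),
    forall x, closure Omega x -> v x = nn_realization (activation a) theta x].

End neural_networks.
Arguments nn_architecture : clear implicits.

(* Main.v *)
Require Import Defs.
From mathcomp Require Import all_boot all_order all_algebra.
From mathcomp Require Import finmap.
From mathcomp Require Import all_classical all_reals all_analysis.
From mathcomp Require Import measurable_realfun.
From mathcomp Require Import ring lra.
Import Order.TTheory GRing.Theory Num.Theory numFieldNormedType.Exports.
Local Open Scope classical_set_scope.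
Local Open Scope ring_scope.

(** Stability of the discrete energy.

Let u and w be the interpolants of v and of f v, G the integral of the squared
norm of the gradient of u over Omega, U and W the integrals of u^2 and of w^2,
and V the volume of Omega.  The energy of v is G/2 minus the integral of w.
Two inequalities bound the second term by the first, with constants that
depend only on the domain, on f, on q and on d:
- W <= D U ([interpolant_L2_stability]), because on each simplex w is
  determined by its values at the lattice points, where it equals f u;
- U <= 4 M^2 G ([poincare]), where M bounds the coordinates on Omega.
Let k = 4 M^2 D + 1.  Young's inequality w <= w^2 / (4 k) + k, integrated over
Omega, bounds the integral of w by W / (4 k) + k V <= G/4 + k V.  An energy at
most C therefore forces G <= 4 C + 4 k V, and U is bounded with G.

The gradient.  Extended by zero, u is continuous on the whole space, and along
every line parallel to a coordinate axis it is polynomial between finitely many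
breakpoints, the ends of the segments that the line cuts out of the simplices.
For such functions with bounded support, the fundamental theorem of calculus on
each line and Fubini's theorem across the lines ([lines_integral0]) show that
partial derivatives have integral zero.  Applied to u phi this is integration
by parts, so the gradient taken simplex by simplex is a weak gradient
([is_weak_gradient_lines]); applied to u^2 x_i it gives the Poincare
inequality.  The energy refers to a chosen weak gradient.  It agrees almost
everywhere with the piecewise one ([weak_gradient_ae]): smooth bumps
approximate the indicators of boxes, and the boxes generate the Borel sets.

One simplex.  A polynomial of degree at most q on a simplex K is recovered from
its values at the principal lattice points of order q, with a bound that is the
same for all K ([hull_lattice_bound]); hence sup |w| <= L sup |f| sup |u| on K.
Conversely |K| sup |u|^2 is at most a constant times the integral of u^2 over K
([hull_inverse_estimate]): if |u| is maximal on K at x0, then |u| stays above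
half of its maximum on the image of K under a homothety of centre x0 whose
ratio depends on q alone.  Both bounds are invariant under affine maps, hence
uniform over the triangulations.  To sum over the simplices it is enough that
two of them overlap in a null set unless one contains the other, which
conformity provides ([conforming_integral_le]). *)

Set Implicit Arguments.
Unset Strict Implicit.
Unset Printing Implicit Defensive.

(** * Borel sets of the space of row vectors *)

Section measure_rV.
Context {R : realType}.
Local Notation leb n := (@lebesgue_rV R n).

(** Cubes with rational centres and radii 1 / (N + 1) suffice.  The closed cubes
are also asked to lie in U, so that bumps supported by them are test functions
on U. *)
Lemma open_bigcup_cubes n (U : set 'rV[R]_n) : open U ->
  exists (I : countType) (D : set I) (c : I -> 'rV[R]_n) (e : I -> R),
  [/\ forall k, 0 < e k,
      U = \bigcup_(k in D) [set x : 'rV[R]_n | forall i, `|x 0 i - c k 0 i| < e k]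
    & forall k, D k -> [set x : 'rV[R]_n | forall i, `|x 0 i - c k 0 i| <= e k] `<=` U].
Proof.
move=> oU.
pose c (k : 'rV[rat]_n * nat) : 'rV[R]_n := map_mx ratr k.1.
pose e (k : 'rV[rat]_n * nat) : R := (k.2.+1%:R)^-1.
exists ('rV[rat]_n * nat)%type.
exists [set k | [set x : 'rV[R]_n | forall i, `|x 0 i - c k 0 i| <= e k] `<=` U], c, e.
split => //; first by move=> k; rewrite invr_gt0.
apply/seteqP; split; last first.
  move=> x [k kU xk]; apply: kU => i; exact/ltW/xk.
move=> x Ux.
have : nbhs x U by move: oU; rewrite openE; exact.
move=> /nbhs_ballP[r /= r0 rU].
(* A cube of radius a whose centre is within a of x lies in the ball of
   radius 2 a around x. *)
have [N [a [aE a0 ar]]] : exists (N : nat) (a : R),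
    [/\ a = (N.+1%:R)^-1, 0 < a & 2 * a < r].
  have r2 : 0 < r / 2 by lra.
  have [N _ /(_ N (leqnn N)) /= HN] := @near_infty_natSinv_lt R (PosNum r2).
  exists N, (N.+1%:R)^-1; split => //.
  by move: HN; rewrite ltr_pdivlMr // mulrC.
have /choice[s sP] : forall i : 'I_n, exists s : rat, `|x 0 i - ratr s| < a.
  move=> i.
  have lt1 : x 0 i < x 0 i + a by rewrite ltrDl.
  have [s] := rat_in_itvoo lt1.
  rewrite in_itv /= => /andP[h1 h2]; exists s; move: (ratr s) h1 h2 => w h1 h2.
  rewrite ltr_norml; apply/andP; split; lra.
exists (\row_i s i, N) => /=.
  move=> y yP; apply: rU; split => // i j; rewrite ord1 /ball /=.
  have := yP j; rewrite /c /e !mxE /= -aE => yj; have sj := sP j.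
  rewrite -(subrKA (ratr (s j))); apply: (le_lt_trans (ler_normD _ _)).
  by rewrite (distrC (ratr _)); move: (ratr _) yj sj => w yj sj; lra.
by move=> i; rewrite /c /e !mxE -aE; exact: sP.
Qed.

Lemma measurable_coord_lt n (i : 'I_n) (c e : R) :
  measurable [set x : 'rV[R]_n | `|x 0 i - c| < e].
Proof.
have := @measurable_rV_coord R n i measurableT `]c - e, c + e[%classic.
move=> /(_ (measurable_itv _)).
congr measurable; apply/seteqP; split => x /=.
  by case=> _; rewrite in_itv /= /rV_coord ltr_norml => /andP[? ?]; apply/andP; split; lra.
rewrite in_itv /= /rV_coord ltr_norml => /andP[? ?]; split => //; apply/andP; split; lra.
Qed.

Lemma measurable_forall_ord n k (A : 'I_k -> set 'rV[R]_n) :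
  (forall i, measurable (A i)) -> measurable [set x | forall i, A i x].
Proof.
move=> mA; rewrite (_ : [set x | _] = \big[setI/setT]_(i < k) A i).
  by apply: bigsetI_measurable => i _; exact: mA.
apply/seteqP; split => [x Ax|x]; first by elim/big_ind: _.
by move=> + i; rewrite (bigD1 i) //= => -[].
Qed.

(** The coordinates generate the open sets because countably many cubes exhaust an
open set. *)
Lemma open_measurable_rV n (U : set 'rV[R]_n) : open U -> measurable U.
Proof.
move=> /open_bigcup_cubes[I [D [c [e [e0 -> _]]]]].
rewrite bigcup_mkcond; apply: countable_bigcupT_measurable => [|k].
  exact: countableP.
case: ifP => // _.
by apply: measurable_forall_ord => i; exact: measurable_coord_lt.
Qed.

Lemma closed_measurable_rV n (A : set 'rV[R]_n) : closed A -> measurable A.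
Proof.
move=> cA; rewrite -[A]setCK; apply: measurableC; apply: open_measurable_rV.
exact: closed_openC.
Qed.

Lemma continuous_measurable_rV n (g : 'rV[R]_n -> R) :
  continuous g -> measurable_fun setT g.
Proof.
move=> cg mD.
refine (@measurability _ _ _ (measurableTypeR R) setT g (@RGenOpens.G R) _ _ mD).
  exact: RGenOpens.measurableE.
move=> _ [_ [a [b -> ] <-]]; rewrite setTI.
apply: open_measurable_rV; apply: open_comp; first by move=> x _; exact: cg.
by apply: interval_open.
Qed.

End measure_rV.

(** * Lebesgue measure as a product *)

Definition box {R : realType} n (M : R) : set 'rV[R]_n :=
  [set x | forall i, `|x 0 i| <= M].
Arguments box {R} n M _.

Section fubini_rV.
Context {R : realType}.
Local Notation lam := (@lebesgue_measure R).
Local Notation leb n := (@lebesgue_rV R n).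

Lemma cons_rVE0 n s (y : 'rV[R]_n) : cons_rV (s, y) 0 ord0 = s.
Proof.
transitivity (row_mx (const_mx s : 'rV[R]_1) y 0 (lshift n 0)).
  by congr (row_mx _ _ _ _); exact: ord_inj.
by rewrite row_mxEl mxE.
Qed.

Lemma cons_rVES n s (y : 'rV[R]_n) j : cons_rV (s, y) 0 (lift ord0 j) = y 0 j.
Proof.
transitivity (row_mx (const_mx s : 'rV[R]_1) y 0 (rshift 1 j)).
  by congr (row_mx _ _ _ _); exact: ord_inj.
by rewrite row_mxEr.
Qed.

(** The measure on R^(n+1) is the image of a product measure, so this puts an
integral in the form to which Fubini's theorem applies, in either order. *)
Lemma integral_rVS n (h : 'rV[R]_n.+1 -> \bar R) :
  (leb n.+1).-integrable setT h ->
  (lam \x leb n)%E.-integrable setT (h \o @cons_rV R n) /\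
  (\int[leb n.+1]_x h x = \int[lam \x leb n]_z h (cons_rV z))%E.
Proof.
move=> ih; have mh := measurable_int _ ih.
have mC := @measurable_cons_rV R n.
have ihC : (lam \x leb n)%E.-integrable setT (h \o @cons_rV R n).
  apply/integrableP; split; first exact: measurableT_comp.
  move/integrableP : ih => [_].
  rewrite -(@ge0_integral_pushforward _ _ _ _ _ _ mC _ setT (abse \o h)) //.
    exact: measurableT_comp.
  by move=> x _; exact: abse_ge0.
split => //.
rewrite -(@integral_pushforward _ _ _ _ _ _ mC _ setT) //.
Qed.

Lemma measurable_box n (M : R) : measurable (box n M).
Proof.
apply: measurable_forall_ord => i; rewrite -[X in measurable X]setTI.
have := @measurable_rV_coord R n i measurableT `[- M, M]%classic (measurable_itv _).
congr measurable; apply/seteqP; split => x /= [_]; rewrite in_itv /= /rV_coord ler_norml //.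
Qed.

Lemma box_finite n (M : R) : (leb n (box n M) < +oo)%E.
Proof.
elim: n => [|n IH].
  rewrite /= /dirac /= indicE; by rewrite ltry.
have -> : leb n.+1 (box n.+1 M) = (lam `[(- M)%R, M]%classic * leb n (box n M))%E.
  rewrite -product_measure1E //; last exact: measurable_box.
  congr ((lam \x leb n)%E _); apply/seteqP; split => [[s y] /= H|[s y] /= [s0 yM] i].
    split; first by have := H ord0; rewrite cons_rVE0 in_itv /= ler_norml.
    by move=> i; have := H (lift ord0 i); rewrite cons_rVES.
  case: (unliftP ord0 i) => [j|] ->; rewrite ?cons_rVES ?cons_rVE0 //.
  by move: s0; rewrite in_itv /= ler_norml.
apply: lte_mul_pinfty => //.
  rewrite lebesgue_measure_itv /=; case: ifP => // _; by rewrite -EFinD.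
Qed.

End fubini_rV.

(** * Integration along lines, and homotheties *)

Section lines_rV.
Context {R : realType}.
Local Notation lam := (@lebesgue_measure R).
Local Notation leb n := (@lebesgue_rV R n).

(** A class of functions that is stable under sums, products and sections, and on
which integrability is automatic. *)
Definition tame n (g : 'rV[R]_n -> R) : Prop :=
  [/\ measurable_fun setT g, exists B, forall x, `|g x| <= B
    & exists M, forall x, g x != 0 -> box n M x].

Lemma tame_integrable n (g : 'rV[R]_n -> R) :
  tame g -> (leb n).-integrable setT (EFin \o g).
Proof.
move=> [mg [B gB] [M gM]].
have mb := @measurable_box R n M.
have : (leb n).-integrable (box n M) (EFin \o g).
  apply: measurable_bounded_integrable => //; first exact: box_finite.
    exact: measurable_funS mg.
  exists B; split; first exact: num_real.
  by move=> C BC x _ /=; apply: (le_trans (gB x)); exact: ltW.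
move/(integrable_mkcond _ mb); congr (_.-integrable _ _).
apply/funext => x /=; rewrite patchE; case: ifPn => // /negP xM.
case: (eqVneq (g x) 0) => [-> //|/gM H]; by exfalso; apply: xM; rewrite inE.
Qed.

Lemma tame_section n (g : 'rV[R]_n.+1 -> R) s :
  tame g -> tame (fun y => g (cons_rV (s, y))).
Proof.
move=> [mg [B gB] [M gM]]; split.
- apply: (measurableT_comp mg); apply: (measurableT_comp (@measurable_cons_rV R n)).
  exact: measurable_pair1.
- by exists B => x; exact: gB.
- by exists M => x /gM H i; have := H (lift ord0 i); rewrite cons_rVES.
Qed.

Lemma line_coord n (x : 'rV[R]_n) t i j :
  (x + t *: delta_mx 0 i) 0 j = x 0 j + t * (j == i)%:R.
Proof. by rewrite !mxE. Qed.

Lemma cons_rV_line0 n s t (y : 'rV[R]_n) :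
  cons_rV (s, y) + t *: delta_mx 0 ord0 = cons_rV (s + t, y).
Proof.
apply/rowP => i; rewrite line_coord.
case: (unliftP ord0 i) => [j|] ->; rewrite ?cons_rVES ?cons_rVE0 /=.
  by rewrite mulr0 addr0.
by rewrite mulr1.
Qed.

Lemma cons_rV_lineS n s t (y : 'rV[R]_n) j :
  cons_rV (s, y) + t *: delta_mx 0 (lift ord0 j) =
  cons_rV (s, y + t *: delta_mx 0 j).
Proof.
apply/rowP => i; rewrite line_coord.
case: (unliftP ord0 i) => [k|] ->; rewrite ?cons_rVES ?cons_rVE0 ?line_coord.
  by rewrite (inj_eq lift_inj).
by rewrite (negbTE (neq_lift _ _)) mulr0 addr0.
Qed.

(** Fubini's theorem with the inner integral along the lines of direction i: by
induction on n, unless i is the first coordinate, these lines lie in the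
sections of constant first coordinate. *)
Lemma integral_lines n (i : 'I_n) (g : 'rV[R]_n -> R) : tame g ->
  (forall x, \int[lam]_t (g (x + t *: delta_mx 0 i))%:E = 0)%E ->
  (\int[leb n]_x (g x)%:E = 0)%E.
Proof.
elim: n => [|n IH] in i g *; first by case: i.
move=> tg g0; have [ig ->] := integral_rVS (tame_integrable tg).
case: (unliftP ord0 i) => [j|] ij.
  rewrite -integral12_prod_meas1 //; apply: integral0_eq => s _.
  rewrite /fubini_F /=; apply: (IH j); first exact: tame_section.
  by move=> y; rewrite -(g0 (cons_rV (s, y))) ij; apply: eq_integral => t _; rewrite cons_rV_lineS.
rewrite -integral21_prod_meas1 //; apply: integral0_eq => y _.
rewrite /fubini_G /= -(g0 (cons_rV (0, y))) ij.
by apply: eq_integral => t _; rewrite cons_rV_line0 add0r.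
Qed.

Lemma measurable_affine (c r : R) : measurable_fun [set: measurableTypeR R] (fun s : measurableTypeR R => c + r * s : measurableTypeR R).
Proof.
apply: measurable_funD => //; exact: measurable_funM.
Qed.

(** Both sides are measures that agree on half-open intervals, which determine
Lebesgue measure. *)
Lemma lebesgue_measure_affine (c r : R) (r0 : 0 < r) (A : set (measurableTypeR R)) :
  measurable A -> (r%:E * lam ((fun s => (c + r * s)%R) @^-1` A) = lam A)%E.
Proof.
move=> mA; pose h : measurableTypeR R -> measurableTypeR R := fun s => c + r * s.
have mh : measurable_fun setT h := measurable_affine c r.
(* The image of Lebesgue measure under h, packed as a measure. *)
have [mu muE] : {mu : {measure set (measurableTypeR R) -> \bar R} |
    mu = pushforward lam h :> (set (measurableTypeR R) -> \bar R)}.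
  unshelve eexists (pushforward lam h : {measure set (measurableTypeR R) -> \bar R}).
    exact: mh.
  by [].
rewrite [RHS](@lebesgue_measure_unique R (mscale (NngNum (ltW r0)) mu)) //; last first.
  move=> X [[a b] _ <-] /=; rewrite /mscale /= muE /pushforward /h.
  rewrite (_ : _ @^-1` _ = `](a - c) / r, (b - c) / r]%classic); last first.
    apply/seteqP; split => s /=; rewrite !in_itv /= ltr_pdivrMr // ler_pdivlMr //;
      rewrite ltrBlDl lerBrDl mulrC //.
  rewrite !lebesgue_measure_itv /= !lte_fin ltr_pM2r ?invr_gt0 // ltrD2r.
  case: ifP => _; last by rewrite mule0.
  rewrite -!EFinD -EFinM; congr EFin; field; lra.
rewrite -[RHS]/(r%:E * mu A)%E muE //.
Qed.

Lemma ge0_integral_affine (c r : R) (r0 : 0 < r) (phi : measurableTypeR R -> \bar R) :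
  measurable_fun setT phi -> (forall s, (0 <= phi s)%E) ->
  (r%:E * \int[lam]_s phi (c + r * s)%R = \int[lam]_s phi s)%E.
Proof.
move=> mphi phi0; pose h : measurableTypeR R -> measurableTypeR R := fun s => c + r * s.
have mh : measurable_fun setT h := measurable_affine c r.
have [mu muE] : {mu : {measure set (measurableTypeR R) -> \bar R} |
    mu = pushforward lam h :> (set (measurableTypeR R) -> \bar R)}.
  unshelve eexists (pushforward lam h : {measure set (measurableTypeR R) -> \bar R}).
    exact: mh.
  by [].
transitivity (\int[mscale (NngNum (ltW r0)) mu]_s phi s)%E; last first.
  apply: eq_measure_integral => A mA _.
  by rewrite /= /mscale /= muE -(lebesgue_measure_affine c r0).
rewrite ge0_integral_mscale //=; congr (_ * _)%E.
transitivity (\int[pushforward lam h]_s phi s)%E.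
  by rewrite ge0_integral_pushforward.
by apply: eq_measure_integral => A mA _; rewrite muE.
Qed.

Lemma homothety_coord n (c x : 'rV[R]_n) r i :
  (c + r *: x) 0 i = c 0 i + r * x 0 i.
Proof. by rewrite !mxE. Qed.

Lemma measurable_homothety n (c : 'rV[R]_n) (r : R) :
  measurable_fun setT (fun x : 'rV[R]_n => c + r *: x).
Proof.
apply: measurable_fun_rV => i.
rewrite (_ : _ \o _ = (fun s => c 0 i + r * s) \o rV_coord i); last first.
  by apply/funext => x; rewrite /= /rV_coord !mxE.
apply: measurableT_comp; [exact: measurable_affine|exact: measurable_rV_coord].
Qed.

(** By induction on n, slicing along the first coordinate: the homothety maps
slices to slices and acts on each of them as a homothety of the same ratio. *)
Lemma lebesgue_rV_homothety n (c : 'rV[R]_n) (r : R) (r0 : 0 < r) (A : set 'rV[R]_n) :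
  measurable A ->
  ((r ^+ n)%:E * leb n ((fun x => (c + r *: x)%R) @^-1` A) = leb n A)%E.
Proof.
elim: n => [|n IH] in c A *.
  move=> mA; rewrite expr0 mul1e; congr (leb 0 _).
  by apply/seteqP; split => x /=; rewrite (_ : c + r *: x = x) //; apply/rowP; case.
move=> mA.
pose B := @cons_rV R n @^-1` A.
have mB : measurable B by rewrite -[B]setTI; exact: measurable_cons_rV.
pose c' := @uncons_rV R n c.
have cE : c = cons_rV c'.
  apply/rowP => i; case: (unliftP ord0 i) => [j|] ->.
    rewrite /c' /uncons_rV cons_rVES mxE; congr (c _ _); exact: ord_inj.
  by rewrite /c' /uncons_rV cons_rVE0.
have consA s y : c + r *: cons_rV (s, y) = cons_rV (c'.1 + r * s, c'.2 + r *: y).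
  rewrite cE; move: c' {cE} => [c1 c2] /=; apply/rowP => i; rewrite homothety_coord.
  by case: (unliftP ord0 i) => [j|] ->; rewrite ?cons_rVES ?cons_rVE0 ?homothety_coord.
pose phi s := leb n (xsection B s).
have mphi : measurable_fun setT phi by exact: measurable_fun_xsection.
have phi0 s : (0 <= phi s)%E by exact: measure_ge0.
have secE s : (fun y => c'.2 + r *: y) @^-1` xsection B (c'.1 + r * s) =
    xsection (@cons_rV R n @^-1` ((fun x => c + r *: x) @^-1` A)) s.
  by apply/seteqP; split => y /=; rewrite /xsection /= !inE /B /= consA.
have -> : leb n.+1 A = (\int[lam]_s phi s)%E by [].
have -> : leb n.+1 ((fun x => c + r *: x) @^-1` A) =
  (\int[lam]_s leb n ((fun y => c'.2 + r *: y)%R @^-1` xsection B (c'.1 + r * s)%R))%E.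
  by apply: eq_integral => s _ /=; rewrite secE.
rewrite exprS EFinM -muleA -ge0_integralZl //; last by rewrite lee_fin exprn_ge0 // ltW.
  rewrite -[RHS](ge0_integral_affine c'.1 r0 mphi phi0); congr (_ * _)%E.
  apply: eq_integral => s _; rewrite IH //; exact: measurable_xsection.
rewrite (_ : (fun s => _) = leb n \o xsection (@cons_rV R n @^-1` ((fun x => c + r *: x) @^-1` A))); last first.
  by apply/funext => s /=; rewrite secE.
apply: measurable_fun_xsection.
rewrite -[X in measurable X]setTI; apply: measurable_cons_rV => //.
by rewrite -[X in measurable X]setTI; exact: measurable_homothety.
Qed.

End lines_rV.

(** * Piecewise continuously differentiable functions of one variable *)

Section piecewise_C1.
Context {R : realType}.
Local Notation lam := (@lebesgue_measure R).
Implicit Types (F G h : R -> R) (S : seq R).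

(** The regularity of finite element functions along lines: F is continuous, and
between consecutive points of a finite set S it has derivative G.  Requiring h
to be continuous on the whole line, and not only on ]a, b[, makes the
derivative extend continuously to both ends, as the fundamental theorem of
calculus needs; the values of G on S are arbitrary. *)
Definition pwC1 F G : Prop := continuous F /\
  exists S, forall a b, a < b -> (forall s, s \in S -> ~~ (a < s < b)) ->
  exists2 h, continuous h &
    forall t, a < t < b -> is_derive t (1 : R) F (h t) /\ G t = h t.

Lemma pwC1_C1 F G : continuous G -> (forall t, is_derive t (1 : R) F (G t)) -> pwC1 F G.
Proof.
move=> cG dF; split.
  move=> t; apply: differentiable_continuous; apply/derivable1_diffP.
  exact: (@ex_derive _ _ _ _ _ _ _ (dF t)).
by exists [::] => a b _ _; exists G.
Qed.

Lemma pwC1M F1 G1 F2 G2 : pwC1 F1 G1 -> pwC1 F2 G2 ->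
  pwC1 (fun t => F1 t * F2 t) (fun t => G1 t * F2 t + F1 t * G2 t).
Proof.
move=> [c1 [S1 P1]] [c2 [S2 P2]]; split.
  by move=> t; apply: cvgM; [exact: c1|exact: c2].
exists (S1 ++ S2) => a b ab avoid.
have [|h1 ch1 d1] := P1 a b ab.
  by move=> s sS; apply: avoid; rewrite mem_cat sS.
have [|h2 ch2 d2] := P2 a b ab.
  by move=> s sS; apply: avoid; rewrite mem_cat sS orbT.
exists (fun t => h1 t * F2 t + F1 t * h2 t).
  move=> t; apply: cvgD; apply: cvgM;
    [exact: ch1|exact: c2|exact: c1|exact: ch2].
move=> t tab; have [D1 ->] := d1 t tab; have [D2 ->] := d2 t tab; split => //.
have := @is_deriveM _ _ F1 F2 t 1 _ _ D1 D2.
by move=> H; apply: is_derive_eq; rewrite addrC /GRing.scale /= (mulrC (h1 t)).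
Qed.

(** By induction on the breakpoints: cutting the interval at one of them leaves two
intervals with fewer breakpoints, and the increments of F add up because F is
continuous. *)
Lemma pwC1_integral_itv F G S a b : a < b -> continuous F ->
  measurable_fun setT G ->
  (forall c d, a <= c -> c < d -> d <= b ->
    (forall s, s \in S -> ~~ (c < s < d)) ->
    exists2 h, continuous h &
      forall t, c < t < d -> is_derive t (1 : R) F (h t) /\ G t = h t) ->
  (\int[lam]_(t in `[a, b]) (G t)%:E = (F b - F a)%:E)%E.
Proof.
move=> + cF mG; elim: S a b => [|s S IH] a b ab H.
  have [//|h ch dh] := H a b (lexx _) ab (lexx _).
  rewrite (@eq_integral_itv_bounded _ _ _ h).
  - rewrite (@continuous_FTC2 _ h F) //.
    + by apply: continuous_subspaceT => t; exact: ch.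
    + split.
      * move=> t; rewrite in_itv /= => /dh[dt _]; exact: (@ex_derive _ _ _ _ _ _ _ dt).
      * by apply: cvg_at_right_filter; exact: cF.
      * by apply: cvg_at_left_filter; exact: cF.
    + move=> t; rewrite in_itv /= => /dh[dt _]; rewrite derive1E; exact: derive_val.
  - exact: measurable_funTS.
  - by apply: measurable_funTS; exact: continuous_measurable_fun.
  - by move=> t; rewrite in_itv /= => /dh[].
have [/andP[as_ sb]|nasb] := boolP (a < s < b); last first.
  apply: IH => // c d ac cd db av; apply: H => // s'.
  rewrite inE => /orP[/eqP ->|]; last exact: av.
  apply: contra nasb => /andP[cs sd].
  by rewrite (le_lt_trans ac cs) (lt_le_trans sd db).
rewrite (@itv_bndbnd_setU _ _ _ (BRight s)) ?bnd_simp ?ltW //.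
rewrite integral_setU //; last 2 first.
- by apply: measurable_funTS; exact/measurable_EFinP.
- apply/disj_setPS => t /= []; rewrite !in_itv /= => /andP[_ h1] /andP[h2 _].
  by move: (le_lt_trans h1 h2); rewrite ltxx.
rewrite integral_itv_obnd_cbnd; last by apply: measurable_funTS; exact/measurable_EFinP.
rewrite IH //; last first.
  move=> c d ac cd ds av; apply: H => //; first exact: (le_trans ds (ltW sb)).
  move=> s'; rewrite inE => /orP[/eqP ->|]; last exact: av.
  by apply/negP => /andP[_]; rewrite ltNge ds.
rewrite IH //; first by rewrite -EFinD; congr EFin; ring.
move=> c d sc cd db av; apply: H => //; first exact: (le_trans (ltW as_) sc).
move=> s'; rewrite inE => /orP[/eqP ->|]; last exact: av.
by apply/negP => /andP[]; rewrite ltNge sc.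
Qed.

Lemma pwC1_integral0 F G (M : R) : pwC1 F G -> measurable_fun setT G ->
  (forall t, M < `|t| -> F t = 0 /\ G t = 0) -> (\int[lam]_t (G t)%:E = 0)%E.
Proof.
move=> [cF [S HS]] mG out.
pose N := `|M| + 1.
have N0 : 0 < N by rewrite /N ltr_wpDl.
have MN : M < N by rewrite /N; apply: (le_lt_trans (ler_norm M)); rewrite ltrDl.
transitivity (\int[lam]_(t in `[(- N)%R, N]) (G t)%:E)%E.
  rewrite [RHS]integral_mkcond; apply: eq_integral => t _; rewrite patchE.
  case: ifPn => // /negP tN; rewrite (out t _).2 // (lt_le_trans MN) // leNgt.
  apply/negP => tlt; apply: tN; rewrite inE /= in_itv /= -ler_norml; exact: ltW.
rewrite (@pwC1_integral_itv F G S) //; last by move=> c d _ cd _; exact: HS.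
  have nN : M < `|N| by rewrite gtr0_norm.
  by rewrite (out N nN).1 (out (- N) _).1 ?normrN // subr0.
by apply: (lt_trans _ N0); rewrite oppr_lt0.
Qed.

End piecewise_C1.

(** * Polynomials: interpolation at the integers and total degree *)

Section newton.
Context {R : realType}.

(** For each n, ell n is the Lagrange basis of the nodes 0, ..., n - 1.  It is
extended by zero to all c, so that interpolants with different numbers of nodes
can be subtracted term by term. *)
Lemma lagrange_family : exists ell : nat -> nat -> {poly R},
  (forall n c, (n <= c)%N -> ell n c = 0) /\
  forall n (p : {poly R}), (size p <= n)%N ->
    p = \sum_(c < n) p.[c%:R] *: ell n c.
Proof.
pose x (c : nat) : R := c%:R.
have x_inj : injective x by move=> a b /eqP; rewrite eqr_nat => /eqP.
pose ell n c : {poly R} := if insub c is Some i then tnth (lagrange n x) i : {poly R} else 0.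
exists ell; split.
  by move=> n c nc; rewrite /ell insubF //; apply/negbTE; rewrite -leqNgt.
move=> [|n] p sp.
  by rewrite big_ord0; apply/eqP; rewrite -size_poly_leq0.
rewrite {1}(lagrange_gen (ltn0Sn n) x_inj sp); apply: eq_bigr => i _.
by rewrite mul_polyC /ell valK.
Qed.

(** The polynomials Q b are the coefficients of the difference between the
interpolants at the nodes 0, ..., b and at the nodes 0, ..., b - 1.  Both
interpolants reproduce X^m once b > m, so the differences vanish from there on,
and their sum telescopes to the interpolant with all nodes. *)
Lemma newton_family : exists Q : nat -> nat -> {poly R},
  (forall b c, (b < c)%N -> Q b c = 0) /\
  forall q m, (m <= q)%N ->
    (forall b, (m < b <= q)%N -> \sum_(c < q.+1) c%:R ^+ m *: Q b c = 0) /\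
    \sum_(b < q.+1) \sum_(c < q.+1) c%:R ^+ m *: Q b c = 'X^m.
Proof.
have [ell [ell0 ellE]] := lagrange_family.
exists (fun b c => ell b.+1 c - ell b c); split.
  by move=> b c bc; rewrite !ell0 ?subrr // ltnW.
move=> q m mq.
pose L n : {poly R} := \sum_(c < q.+1) c%:R ^+ m *: ell n c.
have QE b : \sum_(c < q.+1) c%:R ^+ m *: (ell b.+1 c - ell b c) = L b.+1 - L b.
  by rewrite /L -sumrB; apply: eq_bigr => c _; rewrite scalerBr.
have LE n : (m < n <= q.+1)%N -> L n = 'X^m.
  move=> /andP[mn nq].
  rewrite [RHS](@ellE n) ?size_polyXn // /L.
  rewrite (big_ord_widen q.+1 (fun c : nat => ('X^m).[c%:R] *: ell n c)) //.
  rewrite [RHS]big_mkcond /=; apply: eq_bigr => c _.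
  rewrite hornerXn; case: ltnP => // nc; by rewrite ell0 ?scaler0.
split.
  move=> b /andP[mb bq]; rewrite QE !LE ?subrr //; first by rewrite mb ltnW.
  by rewrite !ltnS bq ltnW.
rewrite (eq_bigr (fun b : 'I_q.+1 => L b.+1 - L b)) => [|b _]; last exact: QE.
rewrite -(big_mkord xpredT (fun b => L b.+1 - L b)) telescope_sumr //.
rewrite LE ?ltnS ?mq ?leqnn // /L big1 ?subr0 // => c _.
by rewrite ell0 ?scaler0.
Qed.

Lemma poly_bounded (p : {poly R}) (K : R) :
  exists2 B, 0 <= B & forall t, `|t| <= K -> `|p.[t]| <= B.
Proof.
exists (\sum_(i < size p) `|p`_i| * `|K| ^+ i).
  by apply: sumr_ge0 => i _; rewrite mulr_ge0 // exprn_ge0.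
move=> t tK; rewrite horner_coef; apply: (le_trans (ler_norm_sum _ _ _)).
apply: ler_sum => i _; rewrite normrM normrX ler_wpM2l //.
rewrite lerXn2r ?nnegrE //; exact: (le_trans tK (ler_norm K)).
Qed.

(** Interpolation at the points c / q writes p(s) - p(0) as a combination of values
of p on [0, 1] whose coefficients depend only on s and tend to 0 with s.  The
continuous function w of the proof is the sum of their absolute values, and
delta is chosen so that w <= 1/2 on [0, delta]. *)
Lemma markov_half q : (0 < q)%N -> exists2 delta : R, 0 < delta <= 1 &
  forall (p : {poly R}) M, (size p <= q.+1)%N ->
    (forall s, 0 <= s <= 1 -> `|p.[s]| <= M) ->
  forall s, 0 <= s <= delta -> `|p.[s] - p.[0]| <= M / 2.
Proof.
move=> q0; have [ell [_ ellE]] := lagrange_family.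
have qR0 : 0 < q%:R :> R by rewrite ltr0n.
pose w (s : R) := \sum_(c < q.+1) `|(ell q.+1 c).[q%:R * s] - (ell q.+1 c).[0]|.
have cw : continuous w.
  have -> : w = fun s => \sum_(c < q.+1)
      `|(ell q.+1 c \Po (q%:R *: 'X) - ((ell q.+1 c).[0])%:P).[s]|.
    apply/funext => s; apply: eq_bigr => c _.
    by rewrite !hornerE horner_comp !hornerE.
  apply: continuous_big => [|c _]; first exact: add_continuous.
  by move=> s; apply: cvg_norm; exact: continuous_horner.
have w0 : w 0 = 0 by rewrite /w big1 // => c _; rewrite mulr0 subrr normr0.
have /cvgrPdist_le/(_ 2^-1) : w s @[s --> 0] --> w 0 by exact: cw.
rewrite invr_gt0 ltr0n => /(_ isT) /nbhs_ballP[e /= e0 eP].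
exists (Num.min 1 (e / 2)).
  by rewrite lt_min ltr01 divr_gt0 //= ge_min lexx.
move=> p M sp pM s /andP[s0]; rewrite le_min => /andP[s1 se].
have ws : w s <= 2^-1.
  have : `|w 0 - w s| <= 2^-1.
    apply: eP; rewrite /ball /= sub0r normrN ger0_norm //; lra.
  by rewrite w0 sub0r normrN; apply: le_trans; exact: ler_norm.
pose r := p \Po (q%:R^-1 *: 'X).
have sr : (size r <= q.+1)%N.
  apply: (leq_trans (size_comp_poly_leq _ _)); rewrite ltnS.
  have : (size (q%:R^-1 *: 'X : {poly R}) <= 2)%N by rewrite (leq_trans (size_scale_leq _ _)) ?size_polyX.
  move=> h; apply: (@leq_trans ((size p).-1 * 1)); last by rewrite muln1; case: (size p) sp.
  by rewrite leq_mul2l; apply/orP; right; case: (size _) h.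
have rE t : r.[t] = p.[t / q%:R] by rewrite /r horner_comp !hornerE mulrC.
have pE t : p.[t] = r.[q%:R * t] by rewrite rE mulrC mulKf // gt_eqF.
rewrite !pE mulr0 (ellE _ _ sr) !horner_sum -sumrB.
apply: (le_trans (ler_norm_sum _ _ _)).
have M0 : 0 <= M by apply: (le_trans _ (pM 0 _)) => //; rewrite lexx ler01.
apply: (@le_trans _ _ (M * w s)); last by rewrite ler_wpM2l.
rewrite /w mulr_sumr; apply: ler_sum => c _.
rewrite !hornerE -mulrBr normrM ler_wpM2r // rE; apply: pM.
by rewrite divr_ge0 //= ler_pdivrMr // mul1r ler_nat -ltnS ltn_ord.
Qed.

End newton.

Section poly_degree.
Context {R : realType}.

(** Total degree at most k.  Building polynomials by multiplication with one
coordinate at a time turns substitution of affine maps, restriction to lines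
and differentiation into structural inductions. *)
Inductive pdeg (d : nat) : nat -> ('rV[R]_d -> R) -> Prop :=
| pdeg_cst k c : pdeg k (fun=> c)
| pdeg_add k G H : pdeg k G -> pdeg k H -> pdeg k (fun x => G x + H x)
| pdeg_mulX k i G : pdeg k G -> pdeg k.+1 (fun x => x 0 i * G x).

Lemma pdegS d k (G : 'rV[R]_d -> R) : pdeg k G -> pdeg k.+1 G.
Proof.
elim=> {k G} [k c|k G H _ IH1 _ IH2|k i G _ IH].
- exact: pdeg_cst.
- exact: pdeg_add.
- exact: pdeg_mulX.
Qed.

Lemma pdeg_leq d k l (G : 'rV[R]_d -> R) : (k <= l)%N -> pdeg k G -> pdeg l G.
Proof.
move=> /subnK <- Gk; elim: (l - k)%N => [|n IH]; rewrite ?add0n // addSn.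
exact: pdegS.
Qed.

Lemma pdegZ d k (a : R) (G : 'rV[R]_d -> R) : pdeg k G -> pdeg k (fun x => a * G x).
Proof.
elim=> {k G} [k c|k G H _ IH1 _ IH2|k i G _ IH].
- exact: pdeg_cst.
- by under eq_fun do rewrite mulrDr; exact: pdeg_add.
- by under eq_fun do rewrite mulrCA; exact: pdeg_mulX.
Qed.

Lemma pdeg_sum d k (I : Type) (s : seq I) (P : pred I) (G : I -> 'rV[R]_d -> R) :
  (forall i, P i -> pdeg k (G i)) -> pdeg k (fun x => \sum_(i <- s | P i) G i x).
Proof.
move=> GP; elim: s => [|i s IH].
  by under eq_fun do rewrite big_nil; exact: pdeg_cst.
have [Pi|nPi] := boolP (P i).
  under eq_fun do rewrite big_cons Pi.
  by apply: pdeg_add => //; exact: GP.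
by under eq_fun do rewrite big_cons (negbTE nPi).
Qed.

Lemma pdeg_comp_affine d m k (G : 'rV[R]_d -> R) (a : 'rV[R]_m -> 'rV[R]_d) :
  (forall i, exists (c : R) (A : 'I_m -> R), forall t, a t 0 i = c + \sum_j A j * t 0 j) ->
  pdeg k G -> pdeg k (fun t => G (a t)).
Proof.
move=> aE; elim=> {k G} [k c|k G H _ IH1 _ IH2|k i G _ IH].
- exact: pdeg_cst.
- exact: pdeg_add.
- have [c [A Ai]] := aE i.
  under eq_fun do rewrite Ai mulrDl mulr_suml.
  apply: pdeg_add; first by apply: pdegS; exact: pdegZ.
  apply: pdeg_sum => j _; under eq_fun do rewrite -mulrA.
  by apply: pdegZ; exact: pdeg_mulX.
Qed.

Lemma pdegXn d k i n (G : 'rV[R]_d -> R) :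
  pdeg k G -> pdeg (n + k) (fun x => x 0 i ^+ n * G x).
Proof.
move=> Gk; elim: n => [|n IH].
  by under eq_fun do rewrite expr0 mul1r.
by under eq_fun do rewrite exprS -mulrA; exact: pdeg_mulX.
Qed.

Lemma pdeg_monomial d (s : seq 'I_d) (b : 'I_d -> nat) :
  @pdeg d (\sum_(i <- s) b i) (fun x => \prod_(i <- s) x 0 i ^+ b i).
Proof.
elim: s => [|i s IH].
  by rewrite big_nil; under eq_fun do rewrite big_nil; exact: pdeg_cst.
rewrite big_cons.
by rewrite (_ : (fun x : 'rV[R]_d => _) = fun x : 'rV[R]_d => x 0 i ^+ b i * \prod_(j <- s) x 0 j ^+ b j);
  [exact: pdegXn|apply/funext => x; rewrite big_cons].
Qed.

Lemma polynomial_fun_pdeg d q (p : 'rV[R]_d -> R) : polynomial_fun q p -> pdeg q p.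
Proof.
move=> [c pE]; rewrite (funext pE : p = _); apply: pdeg_sum => a aq.
apply: pdegZ; apply: (pdeg_leq aq).
exact: (pdeg_monomial _ (fun i => a i : nat)).
Qed.

Lemma pdeg_line d k (G : 'rV[R]_d -> R) x v : pdeg k G ->
  exists2 p : {poly R}, (size p <= k.+1)%N & forall s, G (x + s *: v) = p.[s].
Proof.
elim=> {k G} [k c|k G H _ [p sp pE] _ [r sr rE]|k i G _ [p sp pE]].
- by exists c%:P => [|s]; rewrite ?hornerC // size_polyC (leq_trans (leq_b1 _)).
- exists (p + r) => [|s]; last by rewrite pE rE hornerD.
  by rewrite (leq_trans (size_polyD _ _)) // geq_max sp sr.
- exists (((x 0 i)%:P + v 0 i *: 'X) * p) => [|s].
    apply: (leq_trans (size_polyMleq _ _)).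
    have : (size ((x 0%R i)%:P + v 0%R i *: 'X : {poly R})%R <= 2)%N.
      rewrite (leq_trans (size_polyD _ _)) // geq_max size_polyC.
      rewrite (leq_trans (leq_b1 _)) //= (leq_trans (size_scale_leq _ _)) //.
      by rewrite size_polyX.
    move=> h; have := leq_add h sp; rewrite add2n.
    by case: (_ + _)%N.
  by rewrite !hornerE pE !mxE (mulrC s).
Qed.

Lemma pdeg_partial d k (G : 'rV[R]_d -> R) : pdeg k G ->
  continuous G /\ exists dG : 'I_d -> 'rV[R]_d -> R, forall i,
    continuous (dG i) /\ forall x t,
    is_derive t (1 : R) (fun s => G (x + s *: delta_mx 0 i)) (dG i (x + t *: delta_mx 0 i)).
Proof.
elim=> {k G} [k c|k G H _ [cG [dG dGP]] _ [cH [dH dHP]]|k j G _ [cG [dG dGP]]].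
- split; first exact: cst_continuous.
  exists (fun _ _ => 0) => i; split; first exact: cst_continuous.
  by move=> x t; exact: is_derive_cst.
- split; first by move=> x; exact: (continuousD (cG x) (cH x)).
  exists (fun i x => dG i x + dH i x) => i.
  have [cdG DG] := dGP i; have [cdH DH] := dHP i; split.
    by move=> x; exact: (continuousD (cdG x) (cdH x)).
  by move=> x t; apply: is_deriveD.
- have cX : continuous (fun x : 'rV[R]_d => x 0 j) by exact: coord_continuous.
  split; first by move=> x; exact: (continuousM (cX x) (cG x)).
  exists (fun i x => (j == i)%:R * G x + x 0 j * dG i x) => i.
  have [cdG DG] := dGP i; split.
    move=> x; apply: (continuousD _ (continuousM (cX x) (cdG x))).
    by apply: (continuousM _ (cG x)); exact: cst_continuous.
  move=> x t.
  have DX : is_derive t (1 : R) (fun s : R => (x + s *: delta_mx 0 i) 0 j) (j == i)%:R.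
    under eq_fun do rewrite line_coord.
    have := @is_deriveD _ _ _ (cst (x 0 j)) (fun s : R => s * (j == i)%:R) t 1 0 (j == i)%:R.
    rewrite add0r; apply.
    have := @is_deriveM _ _ id (cst (j == i)%:R) t 1 1 0 (is_derive_id _ _) (is_derive_cst _ _ _).
    by move=> h; apply: is_derive_eq; rewrite scaler0 add0r /GRing.scale /= mulr1.
  have := @is_deriveM _ _ _ _ t 1 _ _ DX (DG x t).
  by move=> h; apply: is_derive_eq; rewrite addrC /GRing.scale /= (mulrC (G _)).
Qed.

End poly_degree.

(** * Interpolation at lattice points *)

Section lattice_interpolation.
Context {R : realType}.

(** W c is the sum over b, |b| <= q, of the products of the one-variable differences
Q (b i) (c i).  Since Q b c = 0 for b < c, only the nodes c with |c| <= q
occur, which are the principal lattice points of a simplex.  The truncation to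
|b| <= q does no harm to a monomial m with |m| <= q: if |b| > q then b i > m i
for some i, and the factor of index i vanishes on m.  So the monomial is
reproduced as by the full tensor product. *)
Lemma newton_reproduction d q :
  exists W : {ffun 'I_d -> 'I_q.+1} -> 'rV[R]_d -> R,
  [/\ forall (c : {ffun 'I_d -> 'I_q.+1}) t, (q < \sum_i c i)%N -> W c t = 0,
      exists2 B, 0 <= B & forall c (t : 'rV[R]_d), (forall i, `|t 0 i| <= q%:R) -> `|W c t| <= B
    & forall G, pdeg q G -> forall t, G t = \sum_c W c t * G (\row_i (c i)%:R)].
Proof.
have [Q [Q0 QE]] := @newton_family R.
pose W (c : {ffun 'I_d -> 'I_q.+1}) (t : 'rV[R]_d) : R :=
  \sum_(b : {ffun 'I_d -> 'I_q.+1} | (\sum_i b i <= q)%N)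
    \prod_i (Q (b i) (c i)).[t 0 i].
exists W; split.
- move=> c t qc; rewrite /W big1 // => b bq.
  have /existsP[i bci] : [exists i, (b i < c i)%N].
    apply: contraLR qc; rewrite negb_exists => /forallP H; rewrite -leqNgt.
    by apply: leq_trans bq; apply: leq_sum => i _; have := H i; rewrite -leqNgt.
  by rewrite (bigD1 i) //= Q0 // horner0 mul0r.
- have /choice[N NP] : forall bc : 'I_q.+1 * 'I_q.+1, exists B, 0 <= B /\
      forall t, `|t| <= q%:R -> `|(Q bc.1 bc.2).[t]| <= B.
    by move=> bc; have [B B0 BP] := poly_bounded (Q bc.1 bc.2) q%:R; exists B.
  pose M := \sum_bc N bc.
  have M0 : 0 <= M by apply: sumr_ge0 => bc _; have [] := NP bc.
  have NM bc : N bc <= M.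
    by rewrite /M (bigD1 bc) //= lerDl sumr_ge0 // => bc' _; have [] := NP bc'.
  exists (\sum_(b : {ffun 'I_d -> 'I_q.+1} | (\sum_i b i <= q)%N) \prod_(i < d) M).
    by apply: sumr_ge0 => b _; apply: prodr_ge0.
  move=> c t tq; apply: (le_trans (ler_norm_sum _ _ _)); apply: ler_sum => b _.
  rewrite normr_prod; apply: ler_prod => i _; rewrite normr_ge0 /=.
  by have [_ H] := NP (b i, c i); exact: (le_trans (H _ (tq i)) (NM _)).
pose mon (m : 'I_d -> nat) (t : 'rV[R]_d) : R := \prod_i t 0 i ^+ m i.
pose E (G : 'rV[R]_d -> R) t := \sum_c W c t * G (\row_i (c i)%:R).
have Emon m t : (\sum_i m i <= q)%N -> E (mon m) t = mon m t.
  move=> mq.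
  have mi i : (m i <= q)%N.
    by apply: leq_trans mq; rewrite (bigD1 i) //= leq_addr.
  pose T b k : {poly R} := \sum_(c < q.+1) c%:R ^+ k *: Q b c.
  transitivity (\sum_(b : {ffun 'I_d -> 'I_q.+1} | (\sum_i b i <= q)%N)
      \prod_i (T (b i) (m i)).[t 0 i]).
    rewrite /E /W; under eq_bigr do rewrite mulr_suml.
    rewrite exchange_big /=; apply: eq_bigr => b _.
    transitivity (\prod_(i < d) \sum_(c < q.+1) (Q (b i) c).[t 0 i] * c%:R ^+ m i).
      rewrite bigA_distr_bigA /=; apply: eq_bigr => c _.
      rewrite /mon -big_split /=; apply: eq_bigr => i _; by rewrite mxE.
    apply: eq_bigr => i _; rewrite /T horner_sum; apply: eq_bigr => c _.
    by rewrite hornerE mulrC.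
  transitivity (\sum_(b : {ffun 'I_d -> 'I_q.+1}) \prod_i (T (b i) (m i)).[t 0 i]).
    rewrite big_mkcond /=; apply: eq_bigr => b _; case: ifPn => // bq.
    have /existsP[i mbi] : [exists i, (m i < b i)%N].
      apply: contraR bq; rewrite negb_exists => /forallP H.
      by apply: leq_trans mq; apply: leq_sum => i _; have := H i; rewrite -leqNgt.
    have [H _] := QE q (m i) (mi i).
    by rewrite (bigD1 i) //= /T H ?horner0 ?mul0r // mbi -ltnS ltn_ord.
  rewrite -(bigA_distr_bigA (fun i (b : 'I_q.+1) => (T b (m i)).[t 0 i])) /mon.
  apply: eq_bigr => i _; have [_ H] := QE q (m i) (mi i).
  by rewrite -horner_sum -(hornerXn (t 0 i) (m i)) -H.
(* The induction over pdeg needs a monomial factor that absorbs the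
   multiplications by coordinates. *)
suff H k G : pdeg k G -> forall m, (\sum_i m i + k <= q)%N ->
    forall t, E (fun x => mon m x * G x) t = mon m t * G t.
  move=> G Gq t; have := H q G Gq (fun=> 0%N).
  rewrite big1 // => /(_ (leqnn _) t).
  have mon1 x : mon (fun=> 0%N) x = 1 by rewrite /mon big1 // => i _; rewrite expr0.
  by rewrite /E mon1 mul1r => <-; apply: eq_bigr => c _; rewrite mon1 mul1r.
elim=> {k G} [k c|k G H _ IH1 _ IH2|k j G _ IH] m mq t.
- rewrite -(Emon m t); last by apply: leq_trans mq; exact: leq_addr.
  by rewrite /E mulr_suml; apply: eq_bigr => c' _; rewrite mulrA.
- rewrite mulrDr -IH1 // -IH2 // /E -big_split /=; apply: eq_bigr => c _.
  by rewrite -mulrDr -mulrDr.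
- pose m' i := (m i + (i == j))%N.
  have mon' x : mon m' x = mon m x * x 0 j.
    rewrite /mon /m'; under eq_bigr do rewrite exprD; rewrite big_split /=.
    congr (_ * _); rewrite (bigD1 j) //= eqxx expr1 big1 ?mulr1 // => i /negbTE ->.
    by rewrite expr0.
  rewrite mulrA -mon' -IH.
    by apply: eq_bigr => c _; rewrite mon' !mulrA.
  rewrite /m' big_split /= (bigD1 j (P := xpredT) (F := fun i => nat_of_bool (i == j))) //=.
  rewrite eqxx (_ : (\sum_(i < d | i != j) (i == j))%N = 0%N) /=.
    by rewrite addn0 addn1 addSn -addnS.
  by rewrite big1 // => i /negbTE ->.
Qed.

(** Lam is a Lebesgue constant of the lattice points c with |c| <= q. *)
Lemma lattice_bound d q : exists2 Lam : R, 0 <= Lam &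
  forall G, @pdeg R d q G -> forall M (t : 'rV[R]_d), (forall i, 0 <= t 0 i <= q%:R) ->
    (forall c : 'I_d -> nat, (\sum_i c i <= q)%N -> `|G (\row_i (c i)%:R)| <= M) ->
  `|G t| <= Lam * M.
Proof.
have [W [W0 [B B0 WB] WE]] := newton_reproduction d q.
exists (\sum_(c : {ffun 'I_d -> 'I_q.+1}) B); first exact: sumr_ge0.
move=> G Gq M t tq GM.
have M0 : 0 <= M.
  have := GM (fun=> 0%N); rewrite big1 // => /(_ isT); exact: le_trans.
rewrite (WE G Gq t); apply: (le_trans (ler_norm_sum _ _ _)).
rewrite mulr_suml; apply: ler_sum => c _; rewrite normrM.
have [cq|qc] := leqP (\sum_i c i) q; last first.
  by rewrite W0 // normr0 mul0r mulr_ge0.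
rewrite ler_pM //; last exact: (GM (fun i => c i : nat)).
by apply: WB => i; have /andP[? ?] := tq i; rewrite ger0_norm.
Qed.

End lattice_interpolation.

(** * Smooth bumps on an interval *)

Section bump1.
Context {R : realType}.
Variables (a b c : R).
Hypothesis c0 : 0 < c.

Let w (t : R) := (t - a) * (b - t).
Let wp : {poly R} := ('X - a%:P) * (b%:P - 'X).

Let wpE t : wp.[t] = w t. Proof. by rewrite /wp /w !hornerE. Qed.

(** The functions P / w^k exp (- c / w) with w = (t - a) (b - t), extended by zero
outside ]a, b[.  This family is closed under differentiation, so all its
members are smooth at once. *)
Definition bump (P : {poly R}) (k : nat) (t : R) : R :=
  if a < t < b then P.[t] / ((t - a) * (b - t)) ^+ k * expR (- c / ((t - a) * (b - t)))
  else 0.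

(** The numerator of the derivative of bump P k, over the denominator w^(k + 2). *)
Definition dbump (P : {poly R}) (k : nat) : {poly R} :=
  P^`() * wp ^+ 2 - k%:R *: (P * wp * wp^`()) + c *: (P * wp^`()).

Let dbumpE P k t : (dbump P k).[t] = P^`().[t] * wp.[t] ^+ 2 -
  k%:R * (P.[t] * wp.[t] * wp^`().[t]) + c * (P.[t] * wp^`().[t]).
Proof. by rewrite /dbump; generalize wp => v; rewrite !hornerE; ring. Qed.

Let w_gt0 t : a < t < b -> 0 < w t.
Proof. by move=> /andP[at_ tb]; rewrite mulr_gt0 // subr_gt0. Qed.

(** From 1 + y <= exp y at y = c / (n x), raised to the power n. *)
Lemma expRN_le (x : R) n : 0 < x -> (0 < n)%N -> expR (- c / x) <= (n%:R * x / c) ^+ n.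
Proof.
move=> x0 n0; have nR0 : 0 < n%:R :> R by rewrite ltr0n.
have y0 : 0 < c / (n%:R * x) by rewrite divr_gt0 // mulr_gt0.
rewrite mulNr expRN -[leRHS]invrK lef_pV2 ?posrE ?expR_gt0 ?invr_gt0 ?exprn_gt0 ?divr_gt0 ?mulr_gt0 //.
have -> : c / x = n%:R * (c / (n%:R * x)) by field; rewrite !gt_eqF.
rewrite expRM_natl -exprVn lerXn2r ?nnegrE ?expR_ge0 ?invr_ge0 ?divr_ge0 ?mulr_ge0 ?(ltW nR0) ?(ltW x0) ?(ltW c0) //.
by rewrite invf_div (le_trans _ (expR_ge1Dx _)) // lerDr.
Qed.

(** For the ends of the interval that supports a bump, where the quotient rule does
not apply. *)
Lemma is_derive_quadratic (f : R -> R) (t M : R) : f t = 0 ->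
  (forall s, `|f s| <= M * (s - t) ^+ 2) -> is_derive t (1 : R) f 0.
Proof.
move=> ft fM; apply/is_derive1_caratheodory.
exists (fun z => if z == t then 0 else f z / (z - t)); split.
- move=> z; rewrite ft subr0; case: eqVneq => [->|zt]; first by rewrite ft mul0r.
  by rewrite divfK // subr_eq0.
- apply/cvgrPdist_le => e e0 /=; rewrite eqxx.
  have M1 : 0 < `|M| + 1 by rewrite ltr_wpDl.
  near=> z; rewrite sub0r normrN; case: eqVneq => [_|zt]; first by rewrite normr0 ltW.
  rewrite normrM normfV ler_pdivrMr ?normr_gt0 ?subr_eq0 //.
  apply: (le_trans (fM z)); rewrite -real_normK ?num_real // expr2 mulrA.
  rewrite ler_wpM2r //; apply: (@le_trans _ _ ((`|M| + 1) * `|z - t|)).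
    by rewrite ler_wpM2r // (le_trans (ler_norm _)) // lerDl.
  rewrite -ler_pdivlMl // mulrC; near: z.
  have e1 : 0 < e / (`|M| + 1) by rewrite divr_gt0.
  apply/nbhs_ballP; exists (e / (`|M| + 1)) => //= y; rewrite /ball /= distrC; exact: ltW.
- by rewrite eqxx.
Unshelve. all: by end_near.
Qed.

(** The exponential beats any power of 1 / w; the exponent 2 is what
[is_derive_quadratic] asks for. *)
Lemma bump_le P k : exists M, forall t, a < t < b -> `|bump P k t| <= M * w t ^+ 2.
Proof.
have [B B0 BP] := poly_bounded P (`|a| + `|b|).
pose n := k.+2; exists (B * (n%:R / c) ^+ n) => t tab.
have wt := w_gt0 tab; rewrite /bump tab -/(w t).
have tB : `|P.[t]| <= B.
  apply: BP; have /andP[at_ tb] := tab.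
  have := ler_norm b; have := ler_norm (- a); rewrite normrN => ha hb.
  rewrite ler_norml; apply/andP; split.
    by have := normr_ge0 b; lra.
  by have := normr_ge0 a; lra.
rewrite normrM (ger0_norm (expR_ge0 _)) normrM normfV (gtr0_norm (exprn_gt0 _ wt)).
apply: (@le_trans _ _ (B / w t ^+ k * (n%:R * w t / c) ^+ n)).
  apply: ler_pM => //; first by rewrite divr_ge0 // exprn_ge0 // ltW.
  - by rewrite ler_wpM2r // invr_ge0 exprn_ge0 // ltW.
  - exact: expRN_le.
move: wt {tab tB}; generalize (w t) => W W0.
rewrite (_ : n%:R * W / c = (n%:R / c) * W); last by rewrite mulrAC.
have WE : W ^+ n = W ^+ k * W ^+ 2 by rewrite -exprD addn2.
have X0 : W ^+ k != 0 by rewrite gt_eqF // exprn_gt0.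
rewrite exprMn WE le_eqVlt; apply/orP; left; apply/eqP; field; exact: X0.
Qed.

Lemma is_derive_bump P k t : is_derive t (1 : R) (bump P k) (bump (dbump P k) k.+2 t).
Proof.
have [tab|ntab] := boolP (a < t < b); last first.
  rewrite {2}/bump (negbTE ntab).
  have [M HM] := bump_le P k.
  (* For t outside ]a, b[ and s inside, w s <= (b - a) |s - t|. *)
  apply: (@is_derive_quadratic _ _ (`|M| * (b - a) ^+ 2)).
    by rewrite /bump (negbTE ntab).
  move=> s; have [sab|nsab] := boolP (a < s < b); last first.
    by rewrite /bump (negbTE nsab) normr0 mulr_ge0 ?sqr_ge0 // mulr_ge0 ?sqr_ge0.
  apply: (le_trans (HM s sab)).
  apply: (@le_trans _ _ (`|M| * w s ^+ 2)); first by rewrite ler_wpM2r ?sqr_ge0 ?ler_norm.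
  rewrite -mulrA ler_wpM2l // -exprMn.
  have /andP[as_ sb] := sab.
  rewrite -(real_normK (num_real ((b - a) * (s - t)))) lerXn2r ?nnegrE //.
    exact/ltW/w_gt0.
  have ba : 0 < b - a by lra.
  rewrite normrM (gtr0_norm ba).
  move: ntab; rewrite negb_and -!leNgt => /orP[ta|bt].
    apply: (@le_trans _ _ ((b - a) * (s - a))).
      by rewrite /w mulrC ler_wpM2r //; lra.
    rewrite ler_wpM2l ?(ltW ba) //; apply: le_trans (ler_norm _); lra.
  apply: (@le_trans _ _ ((b - a) * (b - s))).
    by rewrite /w ler_wpM2r //; lra.
  rewrite ler_wpM2l ?(ltW ba) // distrC; apply: le_trans (ler_norm _); lra.
pose f (s : R) := P.[s] * (wp.[s] ^+ k)^-1 * expR (- c * (wp.[s])^-1).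
have wt : wp.[t] != 0 by rewrite wpE gt_eqF // w_gt0.
have DP := @is_derive_poly R P t; have Dw := @is_derive_poly R wp t.
have Dwk := @is_deriveX _ _ _ k _ _ _ Dw.
have wkt : (horner wp ^+ k) t != 0 by rewrite fctE expf_neq0.
have Dwki := is_deriveV wkt Dwk.
have Dwi := is_deriveV wt Dw.
have Dcw := @is_deriveM _ _ (cst (- c)) _ _ _ _ _ (is_derive_cst (- c) t 1) Dwi.
have De := is_derive1_comp (is_derive_expR _) Dcw.
have D := is_deriveM (is_deriveM DP Dwki) De.
have fD : horner P * (fun y : R => ((horner wp ^+ k) y)^-1) *
    (expR \o (cst (- c) * (fun y : R => wp.[y]^-1))) = f.
  by apply/funext => s; rewrite !fctE.
rewrite fD in D.
have Df : is_derive t (1 : R) f (bump (dbump P k) k.+2 t).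
  apply: is_derive_eq; rewrite /bump tab -/(w t) !fctE /GRing.scale /= dbumpE -wpE.
  move: wt; set W := wp.[t]; set e := expR _; set W' := wp^`().[t] => W0.
  (* Multiplied by W, the term k W^(k-1) of the power rule becomes k W^k also
     when k = 0. *)
  have [X0 kY] : W ^+ k != 0 /\ k%:R * W ^+ k.-1 * W = k%:R * W ^+ k.
    by split; [rewrite expf_neq0|case: (k) => [|j]; rewrite ?mul0r //= -mulrA -exprSr].
  rewrite -[k.+2]addn2 (exprD W k 2).
  move: kY; set Y := k%:R * W ^+ k.-1; set X := W ^+ k in X0 * => kY.
  have kE : k%:R = Y * W / X by rewrite kY mulfK.
  by rewrite kE; field; rewrite W0 X0.
have fE : {near t, f =1 bump P k}.
  have : \near t, t \in `]a, b[ by apply: near_in_itvoo; rewrite in_itv.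
  by apply: filterS => s; rewrite in_itv /= /f /bump => ->; rewrite wpE.
have D1 := near_eq_derivable fE (@ex_derive _ _ _ _ _ _ _ Df).
apply: DeriveDef => //.
rewrite -(@near_eq_derive R R R f (bump P k) t 1 fE); exact: (@derive_val _ _ _ _ _ _ _ Df).
Qed.

End bump1.

(** * Smooth bumps on a box *)

Section product_bumps.
Context {R : realType}.
Local Notation leb n := (@lebesgue_rV R n).

(** Directional derivatives are one-variable derivatives along lines. *)
Lemma is_derive_line n (f : 'rV[R]_n -> R) x v t df :
  is_derive t (1 : R) (fun s => f (x + s *: v)) df <-> is_derive (x + t *: v) v f df.
Proof.
have E : (fun h : R => h^-1 *: (((fun s => f (x + s *: v)) \o shift t) (h *: (1 : R)) -
      f (x + t *: v))) =
    (fun h : R => h^-1 *: ((f \o shift (x + t *: v)) (h *: v) - f (x + t *: v))).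
  apply/funext => h /=; congr (_ *: (f _ - _)).
  have -> : h%:A + t = (h + t)%R :> R by rewrite /GRing.scale /= mulr1.
  by rewrite scalerDl addrCA.
split => -[D V]; constructor.
- by move: D; rewrite /derivable E.
- by move: V; rewrite /derive E.
- by rewrite /derivable E.
- by rewrite /derive E.
Qed.

Lemma continuous_bump (a b c : R) P k : 0 < c -> continuous (bump a b c P k).
Proof.
move=> c0 t; apply: differentiable_continuous; apply/derivable1_diffP.
exact: (@ex_derive _ _ _ _ _ _ _ (is_derive_bump a b c0 P k t)).
Qed.

Lemma bump10_bounds (a b c t : R) : 0 < c -> 0 <= bump a b c 1 0 t <= 1.
Proof.
move=> c0; rewrite /bump; case: ifPn => [/andP[at_ tb]|_]; last by rewrite lexx ler01.
rewrite hornerC expr0 invr1 mulr1 mul1r expR_ge0 /= -expR0 ler_expR.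
rewrite mulNr oppr_le0 divr_ge0 ?mulr_ge0 //; lra.
Qed.

Variables (n : nat) (a b : 'rV[R]_n).

Definition open_box : set 'rV[R]_n := [set x | forall i, a 0 i < x 0 i < b 0 i].
Definition closed_box : set 'rV[R]_n := [set x | forall i, a 0 i <= x 0 i <= b 0 i].

Definition pbump c (P : 'I_n -> {poly R}) (k : 'I_n -> nat) (x : 'rV[R]_n) : R :=
  \prod_i bump (a 0 i) (b 0 i) c (P i) (k i) (x 0 i).

Lemma continuous_pbump c P k : 0 < c -> continuous (pbump c P k).
Proof.
move=> c0; apply: continuous_big => [|i _]; first exact: mul_continuous.
move=> x; apply: (@continuous_comp _ _ _ (fun x : 'rV[R]_n => x 0 i)).
  exact: coord_continuous.
exact: continuous_bump.
Qed.

Lemma is_derive_pbump c P k i x : 0 < c ->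
  is_derive x (delta_mx 0 i) (pbump c P k)
    (pbump c (fun j => if j == i then dbump (a 0 i) (b 0 i) c (P i) (k i) else P j)
           (fun j => if j == i then (k i).+2 else k j) x).
Proof.
move=> c0; rewrite -[x in is_derive x](addr0 x) -(scale0r (delta_mx 0 i)).
apply/is_derive_line.
pose A := \prod_(j < n | j != i) bump (a 0 j) (b 0 j) c (P j) (k j) (x 0 j).
have -> : (fun s => pbump c P k (x + s *: delta_mx 0 i)) =
    A *: (bump (a 0 i) (b 0 i) c (P i) (k i) \o (fun s : R => x 0 i + s)).
  apply/funext => s; rewrite fctE /pbump (bigD1 i) //= line_coord eqxx mulr1 mulrC.
  rewrite /GRing.scale /= /A; congr (_ * _); apply: eq_bigr => j ji.
  by rewrite line_coord (negbTE ji) mulr0 addr0.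
have Dg : is_derive (0 : R) 1 (fun s : R => x 0 i + s) 1.
  have := @is_deriveD _ _ _ (cst (x 0 i)) id (0 : R) 1 0 1.
  move=> /(_ _ _) D.
  by apply: is_derive_eq; rewrite add0r.
have Db := is_derive_bump (a 0 i) (b 0 i) c0 (P i) (k i) (x 0 i + 0).
have Dc := is_derive1_comp Db Dg.
have := @is_deriveZ _ _ _ _ A _ _ _ Dc.
move=> D; apply: is_derive_eq.
rewrite /pbump (bigD1 i) //= !eqxx addr0 mulr1 /GRing.scale /= mulrC.
by congr (_ * _); apply: eq_bigr => j ji; rewrite (negbTE ji).
Qed.

Lemma smooth_pbump c P k : 0 < c -> smooth (pbump c P k).
Proof.
move=> c0 s.
have [P' [k' ->]] : exists P' k', partials s (pbump c P k) = pbump c P' k'.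
  elim: s => [|i s [P' [k' /= ->]]]; first by exists P, k.
  eexists; eexists; apply/funext => x; rewrite /partial.
  exact: (@derive_val _ _ _ _ _ _ _ (is_derive_pbump P' k' i x c0)).
split; first exact: continuous_pbump.
by move=> i x; exact: (@ex_derive _ _ _ _ _ _ _ (is_derive_pbump P' k' i x c0)).
Qed.

Lemma compact_closed_box : compact closed_box.
Proof.
apply: (@rV_compact _ _ (fun i => `[a 0 i, b 0 i]%classic)) => i.
exact: segment_compact.
Qed.

Lemma pbump_out c P k x : ~ open_box x -> pbump c P k x = 0.
Proof.
move=> /existsNP[i /negP xi]; rewrite /pbump (bigD1 i) //= {1}/bump (negbTE xi).
by rewrite mul0r.
Qed.

Lemma test_function_pbump Om c P k : 0 < c -> closed_box `<=` Om ->
  test_function Om (pbump c P k).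
Proof.
move=> c0 bOm; split; first exact: smooth_pbump.
exists closed_box; split => //; first exact: compact_closed_box.
move=> x nx; apply: pbump_out => ox; apply: nx => i.
by have /andP[h1 h2] := ox i; rewrite !ltW.
Qed.

(** As c tends to 0, exp (- c / w) tends to 1 wherever w > 0. *)
Lemma pbump_cvg x : pbump m.+1%:R^-1 (fun=> 1) (fun=> 0%N) x @[m --> \oo] -->
  (\1_open_box x : R).
Proof.
rewrite indicE; have [xb|xnb] := pselect (open_box x); last first.
  rewrite memNset // (_ : (fun m => _) = cst 0); first exact: cvg_cst.
  by apply/funext => m; rewrite pbump_out.
rewrite mem_set //.
have -> : (true%:R : R) = \prod_(i < n) 1 by rewrite big1.
apply: cvg_big => [|i _]; first exact: mul_continuous.
have xi := xb i; rewrite /bump xi.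
set w := (x 0 i - a 0 i) * (b 0 i - x 0 i).
have -> : (fun m => (1 : {poly R}).[x 0 i] / w ^+ 0 * expR (- m.+1%:R^-1 / w)) =
    expR \o (fun m => - m.+1%:R^-1 / w).
  by apply/funext => m; rewrite hornerC expr0 invr1 mulr1 mul1r.
rewrite -[X in _ --> X]expR0; apply: continuous_cvg; first exact: continuous_expR.
rewrite -[X in _ --> X](mul0r w^-1); apply: cvgMl; rewrite -[X in _ --> X]oppr0; apply: cvgN.
exact: cvg_harmonic.
Qed.

Lemma pbump_bounds c x : 0 < c -> 0 <= pbump c (fun=> 1) (fun=> 0%N) x <= 1.
Proof.
move=> c0; rewrite prodr_ge0 /=; last by move=> i _; have /andP[] := bump10_bounds (a 0 i) (b 0 i) (x 0 i) c0.
apply: (@le_trans _ _ (\prod_(i < n) (1 : R))); last by rewrite big1.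
by apply: ler_prod => i _; exact: bump10_bounds.
Qed.

Lemma measurable_open_box : measurable open_box.
Proof.
apply: measurable_forall_ord => i.
have := @measurable_rV_coord R n i measurableT `]a 0 i, b 0 i[%classic (measurable_itv _).
congr measurable; apply/seteqP; split => x /=.
  by case=> _; rewrite in_itv.
by rewrite in_itv.
Qed.

(** Dominated convergence along the bumps that approximate the indicator of the
box. *)
Lemma integral_open_box0 Om (h : 'rV[R]_n -> R) : measurable Om ->
  closed_box `<=` Om -> (leb n).-integrable Om (EFin \o h) ->
  (forall phi, test_function Om phi -> (\int[leb n]_(x in Om) (h x * phi x)%:E = 0)%E) ->
  (\int[leb n]_(x in open_box) (h x)%:E = 0)%E.
Proof.
move=> mOm bOm ih h0.
have mh : measurable_fun Om h by apply/measurable_EFinP; exact: (measurable_int _ ih).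
pose phi m := pbump m.+1%:R^-1 (fun=> 1) (fun=> 0%N).
have c0 m : 0 < m.+1%:R^-1 :> R by rewrite invr_gt0.
have mphi m : measurable_fun Om (phi m).
  apply: measurable_funTS; apply: continuous_measurable_rV; exact: continuous_pbump.
have obOm : open_box `<=` Om.
  move=> x xb; apply: bOm => i; by have /andP[h1 h2] := xb i; rewrite !ltW.
have [|||||_ _] := @dominated_convergence _ _ _ (leb n) Om mOm
  (fun m x => (h x * phi m x)%:E) (fun x => (h x * \1_open_box x)%:E) (fun x => `|(h x)%:E|%E).
- by move=> m; apply/measurable_EFinP; exact: measurable_funM.
- apply/measurable_EFinP; apply: measurable_funM => //.
  apply: measurable_funTS; exact: measurable_indic measurable_open_box.
- apply: aeW => x _; apply: cvg_EFin; first exact: nearW.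
  by apply: cvgMr; exact: pbump_cvg.
- exact: integrable_abse.
- apply: aeW => x m _; rewrite lee_fin normrM ler_piMr //.
  by have /andP[p0 p1] := pbump_bounds x (c0 m); rewrite ger0_norm.
rewrite (_ : [sequence _]_m = cst 0%E); last first.
  apply/funext => m; apply: h0; exact: test_function_pbump.
move=> H.
have : (\int[leb n]_(x in Om) (h x * \1_open_box x)%:E = 0)%E.
  by rewrite -(cvg_lim _ H) // lim_cst.
move=> <-; rewrite -{1}(setIidr obOm) integral_mkcondr; apply: eq_integral => x _.
rewrite patchE indicE; case: ifP => _; by rewrite ?mulr1 ?mulr0.
Qed.

End product_bumps.

(** * Functions orthogonal to all test functions *)

Section uniqueness.
Context {R : realType}.
Local Notation leb n := (@lebesgue_rV R n).

Definition boxes n : set (set 'rV[R]_n) :=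
  [set B | exists a b, B = open_box a b].

Lemma open_boxI n (a1 b1 a2 b2 : 'rV[R]_n) :
  open_box a1 b1 `&` open_box a2 b2 =
  open_box (\row_i Num.max (a1 0 i) (a2 0 i)) (\row_i Num.min (b1 0 i) (b2 0 i)).
Proof.
apply/seteqP; split => x.
  move=> [h1 h2] i; rewrite !mxE gt_max lt_min.
  by have /andP[-> ->] := h1 i; have /andP[-> ->] := h2 i.
move=> h; split => i; have := h i; rewrite !mxE gt_max lt_min;
  by move=> /andP[/andP[? ?] /andP[? ?]]; apply/andP.
Qed.

Lemma boxesI n : setI_closed (@boxes n).
Proof.
move=> _ _ [a1 [b1 ->]] [a2 [b2 ->]]; rewrite open_boxI.
by do 2 eexists.
Qed.

Lemma measurable_boxesE n : @measurable _ 'rV[R]_n = <<s @boxes n >>.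
Proof.
apply/seteqP; split; last first.
  apply: smallest_sub; first exact: sigma_algebra_measurable.
  by move=> _ [a [b ->]]; exact: measurable_open_box.
apply: smallest_sub; first exact: smallest_sigma_algebra.
rewrite -bigcup_seq; apply: bigcup_sub => i _ _ [Y mY <-]; rewrite setTI.
suff : measurable_fun [set: g_sigma_algebraType (@boxes n)]
    (@rV_coord R n i : g_sigma_algebraType (@boxes n) -> measurableTypeR R).
  by move=> /(_ measurableT _ mY); rewrite setTI.
move=> mD.
refine (@measurability _ _ _ (measurableTypeR R) setT _ (@RGenOpens.G R) _ _ mD).
  exact: RGenOpens.measurableE.
move=> _ [_ [a [b -> ] <-]]; rewrite setTI.
rewrite (_ : _ @^-1` _ = \bigcup_N
  open_box (\row_j if j == i then a else - N%:R) (\row_j if j == i then b else N%:R)).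
  apply: bigcupT_measurable => N; apply: sub_sigma_algebra.
  by do 2 eexists; reflexivity.
apply/seteqP; split => x /=; last first.
  by move=> [N _ /(_ i)]; rewrite !mxE eqxx in_itv.
rewrite in_itv /= => xi.
pose M := \sum_j `|x 0 j|.
exists (Num.truncn M).+1 => // j; rewrite !mxE; case: eqVneq => [-> //|_].
rewrite -ltr_norml; apply: le_lt_trans (truncnS_gt M).
by rewrite /M (bigD1 j) //= lerDl sumr_ge0.
Qed.

(** On each of countably many boxes that cover the open set, h has integral zero
over all sub-boxes, hence over all measurable subsets, since boxes are stable
under intersection and generate the sigma-algebra.  So h vanishes almost
everywhere there. *)
Lemma weak_zero_ae n (Om : set 'rV[R]_n) (h : 'rV[R]_n -> R) : open Om ->
  (leb n).-integrable Om (EFin \o h) ->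
  (forall phi, test_function Om phi -> (\int[leb n]_(x in Om) (h x * phi x)%:E = 0)%E) ->
  {ae leb n, forall x, Om x -> h x = 0}.
Proof.
move=> oOm ih h0; have mOm := open_measurable_rV oOm.
have [I [D [c [e [e0 OmE cOm]]]]] := open_bigcup_cubes oOm.
pose a k : 'rV[R]_n := \row_i (c k 0 i - e k).
pose b k : 'rV[R]_n := \row_i (c k 0 i + e k).
have cubeE k : [set x : 'rV[R]_n | forall i, `|x 0 i - c k 0 i| < e k] = open_box (a k) (b k).
  apply/seteqP; split => x H i; have := H i; rewrite !mxE ltr_norml => /andP[? ?]; apply/andP; split; lra.
have ccubeE k : [set x : 'rV[R]_n | forall i, `|x 0 i - c k 0 i| <= e k] = closed_box (a k) (b k).
  apply/seteqP; split => x H i; have := H i; rewrite !mxE ler_norml => /andP[? ?]; apply/andP; split; lra.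
have key k : D k -> {ae leb n, forall x, open_box (a k) (b k) x -> h x = 0}.
  move=> Dk; set B := open_box (a k) (b k).
  have bOm : closed_box (a k) (b k) `<=` Om by rewrite -ccubeE; exact: cOm.
  have BOm : B `<=` Om by move=> x xb; apply: bOm => i; have /andP[h1 h2] := xb i; rewrite !ltW.
  have mB : measurable B by exact: measurable_open_box.
  have ihB : (leb n).-integrable B (EFin \o h) by exact: integrableS ih.
  have subI A : measurable A -> (leb n).-integrable (A `&` B) (EFin \o h).
    by move=> mA; apply: integrableS ihB => //; exact: measurableI.
  have BP : (\int[leb n]_(x in B) (h x)%:E = 0)%E by exact: integral_open_box0 h0.
  have P A : measurable A -> (\int[leb n]_(x in A `&` B) (h x)%:E = 0)%E.
    move=> mA.
    apply: (@dynkin_induction _ _ (@boxes n) (fun A => \int[leb n]_(x in A `&` B) (h x)%:E = 0)%E).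
    - exact: measurable_boxesE.
    - exact: boxesI.
    - by rewrite setTI.
    - move=> _ [a' [b' ->]].
      rewrite open_boxI; apply: integral_open_box0 h0 => //.
      move=> x xb; apply: bOm => i; have := xb i; rewrite !mxE ge_max le_min.
      by move=> /andP[/andP[_ ->] /andP[_ ->]].
    - move=> S mS PS.
      have : (\int[leb n]_(x in (S `&` B) `|` (~` S `&` B)) (h x)%:E = 0)%E.
        by rewrite -setIUl setUv setTI.
      rewrite integral_setU.
      + by rewrite PS add0e.
      + exact: measurableI.
      + by apply: measurableI => //; exact: measurableC.
      + rewrite -setIUl setUv setTI; exact: measurable_int ihB.
      + by apply/disj_setPS => x [[? _] []].
    - move=> F mF tF PF.
      rewrite setI_bigcupl integral_bigcup.
      + by apply: eseries0 => i _ _; exact: PF.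
      + exact: trivIset_setIr.
      + by move=> j; exact: measurableI.
      + rewrite -setI_bigcupl; apply: subI; exact: bigcupT_measurable.
    - by rewrite -measurable_boxesE.
  have : ae_eq (leb n) B (EFin \o h) (cst 0%E).
    apply: integral_ae_eq => // E EB mE.
    by rewrite integral0 -{1}(setIidl EB); exact: P.
  apply: filterS => x H Bx; have := H Bx; by move=> /= [].
rewrite OmE.
(* The boxes are indexed by the countable type I; its codes in nat turn the
   union of null sets into one indexed by the natural numbers. *)
have H : {ae leb n, forall x, forall m : nat,
    (if @choice.unpickle I m is Some k then if k \in D then open_box (a k) (b k) x -> h x = 0 else True else True)}.
  apply: ae_foralln => m; case: (@choice.unpickle I m) => [k|]; last exact: aeW.
  have [kD|kD] := boolP (k \in D); last exact: aeW.
  by apply: key; rewrite inE in kD.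
apply: filterS H => x H [k Dk]; rewrite cubeE => xk.
by have := H (choice.pickle k); rewrite choice.pickleK mem_set // => /(_ xk).
Qed.

End uniqueness.

(** * Barycentric coordinates and faces *)

Section simplex_geometry.
Context {R : realType} {d : nat}.
Local Notation lam1 := (@lebesgue_measure R).
Local Notation leb n := (@lebesgue_rV R n).
Implicit Types (K : simplex R d) (x : 'rV[R]_d).

Definition edges K : 'M[R]_d := \matrix_(i < d) (K (lift ord0 i) - K ord0).

(** Barycentric coordinates with respect to K, as affine functions on the whole
space: the coordinates of positive index are the coefficients of x - K 0 on the
edges at the vertex K 0. *)
Definition bary K x (j : 'I_d.+1) : R :=
  if unlift ord0 j is Some i then ((x - K ord0) *m invmx (edges K)) 0 i
  else 1 - \sum_i ((x - K ord0) *m invmx (edges K)) 0 i.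

Lemma edges_comb K (mu : 'I_d -> R) :
  (\row_i mu i) *m edges K = \sum_i mu i *: (K (lift ord0 i) - K ord0).
Proof.
rewrite mulmx_sum_row; apply: eq_bigr => i _.
by rewrite mxE /edges rowK.
Qed.

Lemma baryE K x (lam : 'I_d.+1 -> R) : Defs.nondegenerate K ->
  \sum_j lam j = 1 -> x = \sum_j lam j *: K j -> forall j, lam j = bary K x j.
Proof.
move=> uK s1 xE.
have xK : x - K ord0 = (\row_i lam (lift ord0 i)) *m edges K.
  rewrite edges_comb; under [RHS]eq_bigr do rewrite scalerBr.
  rewrite sumrB -scaler_suml xE big_ord_recl.
  have -> : \sum_i lam (lift ord0 i) = 1 - lam ord0.
    by rewrite -s1 big_ord_recl addrC addKr.
  by rewrite scalerBl scale1r opprB addrA [X in _ = X - _]addrC.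
have E : (x - K ord0) *m invmx (edges K) = \row_i lam (lift ord0 i).
  by rewrite xK mulmxK.
move=> j; rewrite /bary; case: (unliftP ord0 j) => [i|] ->.
  by rewrite E mxE.
rewrite E; under eq_bigr do rewrite mxE.
by rewrite -s1 big_ord_recl addrK.
Qed.

Lemma sum_bary K x : \sum_j bary K x j = 1.
Proof.
rewrite big_ord_recl {1}/bary unlift_none.
under [X in _ + X]eq_bigr do rewrite /bary liftK.
by rewrite subrK.
Qed.

Lemma bary_comb K x : Defs.nondegenerate K -> x = \sum_j bary K x j *: K j.
Proof.
move=> uK; have := edges_comb K (fun i => bary K x (lift ord0 i)).
rewrite (_ : \row_i _ = (x - K ord0) *m invmx (edges K)); last first.
  by apply/rowP => i; rewrite mxE /bary liftK.
rewrite mulmxKV // => xE.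
rewrite big_ord_recl -[LHS](subrK (K ord0)) xE.
under eq_bigr do rewrite scalerBr.
rewrite sumrB -scaler_suml.
have -> : \sum_i bary K x (lift ord0 i) = 1 - bary K x ord0.
  by rewrite -(sum_bary K x) [in RHS]big_ord_recl addrC addKr.
by rewrite scalerBl scale1r opprB addrA subrK addrC.
Qed.

Lemma bary_affine K j : exists (c : R) (A : 'I_d -> R),
  forall x, bary K x j = c + \sum_k A k * x 0 k.
Proof.
pose N := invmx (edges K).
have mulE x i : ((x - K ord0) *m N) 0 i =
    - (K ord0 *m N) 0 i + \sum_k N k i * x 0 k.
  rewrite mulmxBl addrC; have -> : \sum_k N k i * x 0 k = (x *m N) 0 i.
    by rewrite mxE; apply: eq_bigr => k _; rewrite mulrC.
  by move: (K ord0 *m N) (x *m N) => P Q; rewrite !mxE.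
case: (unliftP ord0 j) => [i|] ->.
  by exists (- (K ord0 *m N) 0 i), (fun k => N k i) => x; rewrite /bary liftK mulE.
exists (1 + \sum_i (K ord0 *m N) 0 i), (fun k => - \sum_i N k i) => x.
rewrite /bary unlift_none; under eq_bigr do rewrite mulE.
rewrite big_split /= sumrN opprD opprK addrA; congr (_ + _).
rewrite exchange_big /= -sumrN; apply: eq_bigr => k _.
by rewrite mulNr mulr_suml.
Qed.

Lemma continuous_bary K j : continuous (fun x => bary K x j).
Proof.
have [c [A E]] := bary_affine K j; rewrite (funext E).
have cS : continuous (fun x : 'rV[R]_d => \sum_k A k * x 0 k).
  apply: continuous_big => [|k _]; first exact: add_continuous.
  move=> x; apply: (@continuousM _ _ (cst (A k)) (fun x : 'rV[R]_d => x 0 k)).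
    exact: cst_continuous.
  exact: coord_continuous.
move=> x; apply: (@continuousD _ _ _ (cst c)); first exact: cst_continuous.
exact: cS.
Qed.

(** Turns the existential description of a face into closed conditions on affine
functions of x. *)
Lemma faceP K I : Defs.nondegenerate K -> face K I =
  [set x | (forall j, 0 <= bary K x j) /\ (forall j, j \notin I -> bary K x j = 0)].
Proof.
move=> uK; apply/seteqP; split => x /=.
  move=> [lam [lam0 lamI s1 xE]]; have E := baryE uK s1 xE.
  by split => j; rewrite -E //; exact: lamI.
move=> [b0 bI]; exists (bary K x); split => //; first exact: sum_bary.
exact: bary_comb.
Qed.

Lemma closed_face K I : Defs.nondegenerate K -> closed (face K I).
Proof.
move=> uK; rewrite faceP //.
rewrite (_ : [set x | _] = \bigcap_j ((fun x => bary K x j) @^-1` [set t | 0 <= t]) `&`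
  \bigcap_(j in [set j | j \notin I]) ((fun x => bary K x j) @^-1` [set t | t = 0])); last first.
  apply/seteqP; split => x /= [h1 h2].
    by split => j; [move=> _; exact: h1|exact: h2].
  by split => j; [exact: h1|exact: h2].
by apply: closedI; apply: closed_bigI => j _;
  apply: closed_comp => [x _|]; [exact: continuous_bary|exact: closed_ge|
    exact: continuous_bary|exact: closed_eq].
Qed.

Lemma measurable_face K I : Defs.nondegenerate K -> measurable (face K I).
Proof. by move=> uK; apply: closed_measurable_rV; exact: closed_face. Qed.

Lemma hull_convex K x y (s : R) : 0 <= s <= 1 -> hull K x -> hull K y ->
  hull K ((1 - s) *: x + s *: y).
Proof.
move=> /andP[s0 s1] [l1 [p1 _ e1 ->]] [l2 [p2 _ e2 ->]].
exists (fun j => (1 - s) * l1 j + s * l2 j); split.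
- by move=> j; rewrite addr_ge0 // mulr_ge0 // subr_ge0.
- by move=> j; rewrite inE.
- by rewrite big_split /= -!mulr_sumr e1 e2 !mulr1 subrK.
- rewrite !scaler_sumr -big_split /=; apply: eq_bigr => j _.
  by rewrite [RHS]scalerDl !scalerA.
Qed.

Lemma hull_bounded K : exists M, hull K `<=` box d M.
Proof.
exists (\sum_i \sum_j `|K j 0 i|) => x [lam [l0 _ s1 ->]] i.
rewrite summxE; apply: (le_trans (ler_norm_sum _ _ _)).
rewrite (bigD1 i) //= -[leLHS]addr0 lerD //; last first.
  by apply: sumr_ge0 => k _; apply: sumr_ge0.
apply: ler_sum => j _; rewrite mxE normrM ler_piMl // ger0_norm //.
by rewrite -s1 (bigD1 j) //= lerDl sumr_ge0.
Qed.

Lemma hull_vertex K j : hull K (K j).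
Proof.
exists (fun k => (k == j)%:R); split.
- by move=> k; rewrite ler0n.
- by move=> k; rewrite inE.
- by rewrite (bigD1 j) //= eqxx big1 ?addr0 // => k /negbTE ->.
- rewrite (bigD1 j) //= eqxx scale1r big1 ?addr0 // => k /negbTE ->.
  by rewrite scale0r.
Qed.

(** A proper face lies in the zero set of a barycentric coordinate.  This affine
function is not constant, so it has a nonzero slope along some axis, and each
line parallel to that axis meets the zero set in a single point. *)
Lemma face_null K I : (0 < d)%N -> Defs.nondegenerate K -> I != [set: 'I_d.+1]%SET ->
  leb d (face K I) = 0%E.
Proof.
move=> d0 uK IT.
have [j jI] : exists j, j \notin I.
  apply/existsP; apply: contraR IT => /existsPn H; apply/eqP/setP => j.
  by rewrite inE; have := H j; rewrite negbK.
have mA := measurable_face I uK.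
have [c [A bE]] := bary_affine K j.
have [i Ai] : exists i, A i != 0.
  apply/existsP; apply: contraT => /existsPn H.
  have bc x : bary K x j = c.
    rewrite bE big1 ?addr0 // => k _; have := H k; rewrite negbK => /eqP ->.
    by rewrite mul0r.
  (* At the vertices the coordinate takes both values 0 and 1. *)
  have vE k l : bary K (K k) l = (l == k)%:R.
    rewrite -(@baryE K (K k) (fun l => (l == k)%:R)) //.
      by rewrite (bigD1 k) //= eqxx big1 ?addr0 // => m /negbTE ->.
    rewrite (bigD1 k) //= eqxx scale1r big1 ?addr0 // => m /negbTE ->.
    by rewrite scale0r.
  pose k := if j == ord0 then ord_max else ord0 : 'I_d.+1.
  have jk : j != k.
    rewrite /k; have [j0|//] := eqVneq j ord0; rewrite j0.
    by apply/eqP => /(congr1 val) /= d00; move: d0; rewrite -d00.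
  by have := bc (K j); rewrite -(bc (K k)) !vE eqxx (negbTE jk) => /eqP; rewrite oner_eq0.
have tA : tame (\1_(face K I) : 'rV[R]_d -> R).
  split; first exact: measurable_indic.
    by exists 1 => x; rewrite indicE; case: (_ \in _); rewrite ?normr1 ?normr0.
  have [M HM] := hull_bounded K; exists M => x; rewrite indicE.
  case: (boolP (x \in _)) => [|_]; last by rewrite eqxx.
  rewrite inE => -[lam [l0 _ s1 xE]] _; apply: HM; exists lam; split => //.
  by move=> k; rewrite inE.
rewrite -[LHS](_ : (\int[leb d]_x (\1_(face K I) x)%:E = _)%E); last first.
  by rewrite integral_indic // setIT.
apply: (integral_lines (i := i)) => // x.
pose t0 := - bary K x j / A i.
have bline t : bary K (x + t *: delta_mx 0 i) j = bary K x j + A i * t.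
  rewrite !bE -addrA; congr (_ + _).
  rewrite (bigD1 i) //= [in RHS](bigD1 i) //= line_coord eqxx mulr1 mulrDr.
  rewrite addrAC; congr (_ + _ + _); apply: eq_bigr => k ki.
  by rewrite line_coord (negbTE ki) mulr0 addr0.
transitivity (\int[lam1]_(t in [set t0]) (\1_(face K I) (x + t *: delta_mx 0 i))%:E)%E.
  rewrite [RHS]integral_mkcond; apply: eq_integral => t _; rewrite patchE.
  case: ifPn => // /negP tt0; rewrite indicE memNset // faceP // => -[_ /(_ j jI)].
  rewrite bline => /eqP; rewrite addrC addr_eq0 => /eqP E; apply: tt0; rewrite inE /= /t0 -E.
  by field.
by rewrite integral_set1.
Qed.

End simplex_geometry.

(** * Functions given simplex by simplex *)

Section piecewise.
Context {R : realType} {d : nat}.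
Local Notation leb n := (@lebesgue_rV R n).
Implicit Types (K : simplex R d) (x : 'rV[R]_d) (u g : 'rV[R]_d -> R).

Lemma tameD u g : tame u -> tame g -> tame (fun x => u x + g x).
Proof.
move=> [mu [B uB] [M uM]] [mg [C gC] [N gN]]; split.
- exact: measurable_funD.
- by exists (B + C) => x; apply: (le_trans (ler_normD _ _)); exact: lerD.
- exists (Num.max M N) => x ug i; rewrite le_max; apply/orP.
  have [u0|/uM/(_ i)] := eqVneq (u x) 0; last by left.
  by right; apply: gN; rewrite u0 add0r in ug.
Qed.

Lemma continuous_box_bounded (phi : 'rV[R]_d -> R) M : continuous phi ->
  exists B, forall x, box d M x -> `|phi x| <= B.
Proof.
move=> cphi.
have cb : compact (closed_box (\row_(i < d) - M) (\row_(i < d) M)).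
  exact: compact_closed_box.
have cim : compact (phi @` closed_box (\row_(i < d) - M) (\row_(i < d) M)).
  by apply: continuous_compact => //; apply: continuous_subspaceT => x; exact: cphi.
have [B [_ HB]] := compact_bounded cim.
exists (`|B| + 1) => x xM; apply: (HB (`|B| + 1)).
  by apply: (le_lt_trans (ler_norm B)); rewrite ltrDl.
by exists x => // i; rewrite !mxE -ler_norml.
Qed.

Lemma tameM u (phi : 'rV[R]_d -> R) : tame u -> measurable_fun setT phi ->
  (forall M, exists B, forall x, box d M x -> `|phi x| <= B) ->
  tame (fun x => u x * phi x).
Proof.
move=> [mu [B uB] [M uM]] mphi bphi; split.
- exact: measurable_funM.
- have [C HC] := bphi M; exists (B * `|C|) => x; rewrite normrM.
  have [->|/uM xM] := eqVneq (u x) 0.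
    by rewrite normr0 mul0r mulr_ge0 // (le_trans _ (uB x)).
  by rewrite ler_pM // (le_trans (HC x xM)) // ler_norm.
- exists M => x; have [->|/uM //] := eqVneq (u x) 0.
  by rewrite mul0r eqxx.
Qed.

Lemma tameM_cont u (phi : 'rV[R]_d -> R) : tame u -> continuous phi ->
  tame (fun x => u x * phi x).
Proof.
move=> tu cphi; apply: tameM => //; first exact: continuous_measurable_rV.
by move=> M; exact: continuous_box_bounded.
Qed.

Lemma tameM_tame u g : tame u -> tame g -> tame (fun x => u x * g x).
Proof.
move=> tu [mg [B gB] _]; apply: tameM => // M; by exists B => x _; exact: gB.
Qed.

Lemma measurable_line x (i : 'I_d) :
  measurable_fun [set: measurableTypeR R]
    (fun t : measurableTypeR R => x + (t : R) *: delta_mx 0 i).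
Proof.
apply: measurable_fun_rV => j.
rewrite (_ : _ \o _ = fun t : measurableTypeR R =>
    x 0 j + (j == i)%:R * t : measurableTypeR R); last first.
  by apply/funext => t; rewrite /= /rV_coord line_coord mulrC.
exact: measurable_affine.
Qed.

Lemma continuous_line x (i : 'I_d) :
  continuous (fun t : R => x + t *: delta_mx 0 i : 'rV[R]_d).
Proof.
move=> t; apply: (@cvgD _ 'rV[R]_d); first exact: cvg_cst.
exact: scalel_continuous.
Qed.

(** On each line the integral is the increment of F between two points outside its
support. *)
Lemma lines_integral0 (F G : 'rV[R]_d -> R) (i : 'I_d) : tame F -> tame G ->
  (forall x, pwC1 (fun t => F (x + t *: delta_mx 0 i)) (fun t => G (x + t *: delta_mx 0 i))) ->
  (\int[leb d]_x (G x)%:E = 0)%E.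
Proof.
move=> [mF _ [M FM]] tG; have [mG _ [N GN]] := tG => FG.
apply: (integral_lines (i := i)) => // x.
apply: (@pwC1_integral0 _ _ _ (Num.max M N + `|x 0 i|)).
- exact: (FG x).
- by apply: (measurableT_comp mG); exact: measurable_line.
- move=> t tM.
  have H L : L <= Num.max M N -> ~ box d L (x + t *: delta_mx 0 i).
    move=> LM /(_ i); rewrite line_coord eqxx mulr1 => h.
    have := le_lt_trans (lerD (lexx L) (lexx `|x 0 i|)) (le_lt_trans (lerD LM (lexx _)) tM).
    apply/negP; rewrite -leNgt -{1}(addKr (x 0 i) t) addrC.
    by apply: (le_trans (ler_normB _ _)); rewrite lerD.
  split; apply/eqP; apply: contraT => /= h; exfalso.
    by apply: (H M); [rewrite le_max lexx|exact: FM].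
  by apply: (H N); [rewrite le_max lexx orbT|exact: GN].
Qed.

(** A function given by one formula for each simplex of a list.  Where simplices
overlap and the formulas disagree, as the pieces of a gradient do on common
faces, the first simplex decides. *)
Fixpoint glue (s : seq (simplex R d)) (F : simplex R d -> 'rV[R]_d -> R) x : R :=
  if s is K :: s' then if `[< hull K x >] then F K x else glue s' F x else 0.

Lemma tame_glue s F : (forall K, K \in s -> Defs.nondegenerate K) ->
  (forall K, K \in s -> continuous (F K)) -> tame (glue s F).
Proof.
elim: s => [|K s IH] nd cF.
  split => /=; first exact: measurable_cst.
    by exists 0 => x; rewrite normr0.
  by exists 0 => x; rewrite eqxx.
have [m1 [B HB] [M HM]] : tame (glue s F).
  by apply: IH => K' K's; [apply: nd|apply: cF]; rewrite inE K's orbT.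
have [N HN] := hull_bounded K.
have cK : continuous (F K) by apply: cF; rewrite mem_head.
have mK : measurable (hull K) by apply: measurable_face; apply: nd; rewrite mem_head.
have [C HC] := continuous_box_bounded N cK.
split.
- rewrite (_ : glue _ _ = fun x => if x \in hull K then F K x else glue s F x); last first.
    by apply/funext => x.
  apply: measurable_fun_ifT => //.
    apply: (measurable_fun_bool true); rewrite setTI.
    rewrite (_ : _ @^-1` _ = hull K) //.
    by apply/seteqP; split => x /=; [exact: set_mem|exact: mem_set].
  exact: continuous_measurable_rV.
- exists (Num.max B C) => x /=; rewrite le_max; case: asboolP => [/HN/HC ->|_].
    by rewrite orbT.
  by rewrite HB.
- exists (Num.max M N) => x /=; case: asboolP => [/HN xN _|_ /HM xM] i; rewrite le_max.
    by rewrite xN orbT.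
  by rewrite xM.
Qed.

(** The simplex is chosen before F, so that on an interval without breakpoints a
glued function and its glued derivative use the same piece. *)
Lemma glue_line_const x s t0 (a b : R) (i : 'I_d) : a < t0 < b ->
  (forall K t t', K \in s -> a < t < b -> a < t' < b ->
    hull K (x + t *: delta_mx 0 i) -> hull K (x + t' *: delta_mx 0 i)) ->
  (exists2 K, K \in s & forall t F, a < t < b ->
     glue s F (x + t *: delta_mx 0 i) = F K (x + t *: delta_mx 0 i)) \/
  (forall t F, a < t < b -> glue s F (x + t *: delta_mx 0 i) = 0).
Proof.
move=> t0ab; elim: s => [|K s IH] H; first by right.
have [hK|hK] := pselect (hull K (x + t0 *: delta_mx 0 i)).
  left; exists K; first by rewrite mem_head.
  move=> t F tab /=; rewrite asboolT //.
  by apply: (H K t0 t) => //; rewrite mem_head.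
have nK t : a < t < b -> ~ hull K (x + t *: delta_mx 0 i).
  by move=> tab h; apply: hK; apply: (H K t t0) => //; rewrite mem_head.
have [|[K' K's E]|E] := IH.
- by move=> K' t t' K's; apply: H; rewrite inE K's orbT.
- left; exists K'; first by rewrite inE K's orbT.
  by move=> t F tab /=; rewrite asboolF ?E //; exact: nK.
- by right => t F tab /=; rewrite asboolF ?E //; exact: nK.
Qed.

(** A line meets a bounded convex set in a segment, so two breakpoints suffice: its
ends. *)
Lemma hull_line_avoid K x (i : 'I_d) : exists S : seq R, forall a b,
  (forall s, s \in S -> ~~ (a < s < b)) ->
  forall t t', a < t < b -> a < t' < b ->
    hull K (x + t *: delta_mx 0 i) -> hull K (x + t' *: delta_mx 0 i).
Proof.
pose I := [set t | hull K (x + t *: delta_mx 0 i)].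
have [N HN] := hull_bounded K.
have bI t : I t -> `|t| <= N + `|x 0 i|.
  move=> /HN/(_ i); rewrite line_coord eqxx mulr1 => h.
  rewrite -{1}(addKr (x 0 i) t) addrC.
  by apply: (le_trans (ler_normB _ _)); rewrite lerD.
have ubI : has_ubound I.
  by exists (N + `|x 0 i|) => t /bI; apply: le_trans; exact: ler_norm.
have lbI : has_lbound I.
  by exists (- (N + `|x 0 i|)) => t /bI; rewrite ler_norml => /andP[].
have cvx t1 t2 t : I t1 -> I t2 -> t1 <= t <= t2 -> I t.
  move=> I1 I2 /andP[h1 h2].
  have [t12|t12] := eqVneq t1 t2.
    by have -> : t = t1 by apply/eqP; rewrite eq_le h1 t12 h2.
  have t12' : 0 < t2 - t1.
    by rewrite subr_gt0 lt_neqAle t12 (le_trans h1 h2).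
  pose s := (t - t1) / (t2 - t1).
  have s01 : 0 <= s <= 1.
    by rewrite /s divr_ge0 ?subr_ge0 ?(le_trans h1 h2) //= ler_pdivrMr // mul1r lerD2r.
  have := hull_convex s01 I1 I2; rewrite /I /=; congr (hull K _).
  apply/rowP => j; rewrite !mxE.
  have -> : t = (1 - s) * t1 + s * t2 by rewrite /s; field; rewrite gt_eqF.
  ring.
exists [:: inf I; sup I] => a b av t t' /andP[at_ tb] /andP[at' tb'] It.
have nsup := av (sup I); have ninf := av (inf I).
rewrite !inE !eqxx ?orbT in nsup ninf.
have It' : I t; first by [].
apply: contrapT => nIt'.
have [tt'|t't] := leP t t'.
  have : a < sup I < b; last by move=> h; move: (nsup isT); rewrite h.
  apply/andP; split; first by apply: (lt_le_trans at_); exact: ub_le_sup.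
  apply: (le_lt_trans _ tb'); apply: ge_sup; first by exists t.
  move=> y Iy; rewrite leNgt; apply/negP => t'y; apply: nIt'.
  by apply: (cvx t y) => //; rewrite tt' ltW.
have : a < inf I < b; last by move=> h; move: (ninf isT); rewrite h.
apply/andP; split; last by apply: (le_lt_trans _ tb); exact: ge_inf.
apply: (lt_le_trans at'); apply: lb_le_inf; first by exists t.
move=> y Iy; rewrite leNgt; apply/negP => yt'; apply: nIt'.
by apply: (cvx y t) => //; rewrite (ltW t't) ltW.
Qed.

Lemma glue_lines s (P : simplex R d -> 'rV[R]_d -> R) (dP : simplex R d -> 'rV[R]_d -> R)
    (i : 'I_d) x :
  continuous (fun t : R => glue s P (x + t *: delta_mx 0 i)) ->
  (forall K, K \in s -> continuous (dP K)) ->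
  (forall K, K \in s -> forall t, is_derive t (1 : R)
    (fun t : R => P K (x + t *: delta_mx 0 i)) (dP K (x + t *: delta_mx 0 i))) ->
  pwC1 (fun t : R => glue s P (x + t *: delta_mx 0 i)) (fun t : R => glue s dP (x + t *: delta_mx 0 i)).
Proof.
move=> cP cdP DP; split => //.
have /choice[S HS] : forall K, exists S : seq R, forall a b,
  (forall s, s \in S -> ~~ (a < s < b)) ->
  forall t t', a < t < b -> a < t' < b ->
    hull K (x + t *: delta_mx 0 i) -> hull K (x + t' *: delta_mx 0 i).
  by move=> K; exact: hull_line_avoid.
exists (flatten [seq S K | K <- s]) => a b ab av.
have t0ab : a < (a + b) / 2 < b by apply/andP; split; lra.
have [|[K Ks E]|E] := @glue_line_const x s _ a b i t0ab.
- move=> K t t' Ks; apply: HS => r rS; apply: av.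
  by apply/flattenP; exists (S K) => //; exact: map_f.
- exists (fun t => dP K (x + t *: delta_mx 0 i)).
    move=> t; apply: (@continuous_comp _ _ _ (fun t : R => x + t *: delta_mx 0 i : 'rV[R]_d)).
      exact: continuous_line.
    exact: cdP.
  move=> t tab; rewrite E //; split => //.
  have nE : {near t, (fun t : R => P K (x + t *: delta_mx 0 i)) =1 (fun t : R => glue s P (x + t *: delta_mx 0 i))}.
    have : \near t, t \in `]a, b[ by apply: near_in_itvoo; rewrite in_itv.
    by apply: filterS => r; rewrite in_itv /= => /E ->.
  apply: DeriveDef.
    exact: (near_eq_derivable nE (@ex_derive _ _ _ _ _ _ _ (DP K Ks t))).
  rewrite -(@near_eq_derive R R R _ _ t 1 nE).
  exact: (@derive_val _ _ _ _ _ _ _ (DP K Ks t)).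
- exists (fun=> 0); first exact: cst_continuous.
  move=> t tab; rewrite E //; split => //.
  have nE : {near t, (fun=> 0) =1 (fun t : R => glue s P (x + t *: delta_mx 0 i))}.
    have : \near t, t \in `]a, b[ by apply: near_in_itvoo; rewrite in_itv.
    by apply: filterS => r; rewrite in_itv /= => /E ->.
  have D0 := is_derive_cst (0 : R) t (1 : R).
  apply: DeriveDef.
    exact: (near_eq_derivable nE (@ex_derive _ _ _ _ _ _ _ D0)).
  rewrite -(@near_eq_derive R R R _ _ t 1 nE).
  exact: (@derive_val _ _ _ _ _ _ _ D0).
Qed.

End piecewise.

(** * Finite element functions along lines *)

Section fe_functions.
Context {R : realType} {d : nat}.
Variables (Om : set 'rV[R]_d).
Hypotheses (oOm : open Om).

Lemma continuous_zero_extension (u : 'rV[R]_d -> R) :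
  {within closure Om, continuous u} -> (forall x, boundary Om x -> u x = 0) ->
  continuous (u \_ (closure Om)).
Proof.
move=> /subspace_continuousP cu u0 x; apply/(@cvgrPdist_lt _ _ _ (nbhs x)) => e e0.
have [cx|ncx] := pselect (closure Om x); last first.
  have : nbhs x (~` closure Om).
    by apply: open_nbhs_nbhs; split => //; apply: closed_openC; exact: closed_closure.
  apply: filterS => y ncy; rewrite !patchE !memNset // subrr normr0 //.
have := cu x cx => /cvgrPdist_lt /(_ e e0); rewrite near_withinE => nu.
have [Ox|nOx] := pselect (Om x).
  have nO : \forall y \near x, Om y by apply: open_nbhs_nbhs.
  near=> y; rewrite !patchE !mem_set //.
    by near: y; apply: filterS2 nu nO => y H Oy; apply: H; exact: subset_closure.
  by apply: subset_closure; near: y.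
have ux : u x = 0 by apply: u0; rewrite /boundary ((interior_id _).1 oOm).
near=> y; rewrite !patchE (mem_set cx); case: ifPn => [/set_mem cy|_].
  by move: cy; near: y.
by rewrite ux subrr normr0.
Unshelve. all: by end_near.
Qed.

Variables (T : {fset simplex R d}) (q : nat) (u : 'rV[R]_d -> R).
Hypotheses (T_nd : forall K, K \in T -> Defs.nondegenerate K)
  (T_carrier : carrier T = closure Om) (u_fe : fe_space Om T q u).

Lemma fe_pieces : exists2 P : simplex R d -> 'rV[R]_d -> R,
  (forall K, K \in T -> pdeg q (P K)) &
  (forall K x, K \in T -> hull K x -> u x = P K x).
Proof.
have [_ Tu _] := u_fe.
have /choice[P HP] : forall K, exists p : 'rV[R]_d -> R, K \in T ->
    pdeg q p /\ forall x, hull K x -> u x = p x.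
  move=> K; have [/Tu[p pp uE]|nK] := boolP (K \in T); last by exists (fun=> 0).
  by exists p; split => //; exact: polynomial_fun_pdeg.
by exists P => [K /HP[]|K x /HP[_]] //; exact.
Qed.

(** g is the gradient taken simplex by simplex. *)
Lemma fe_gradient : exists g : 'I_d -> 'rV[R]_d -> R,
  [/\ continuous (u \_ (closure Om)), tame (u \_ (closure Om)), forall i, tame (g i)
    & forall i x, pwC1 (fun t : R => (u \_ (closure Om)) (x + t *: delta_mx 0 i))
                       (fun t : R => g i (x + t *: delta_mx 0 i))].
Proof.
have [P Pq PE] := fe_pieces; have [cu _ bu] := u_fe.
have c0 := continuous_zero_extension cu bu.
have uE : u \_ (closure Om) = glue T P.
  apply/funext => x; rewrite patchE -T_carrier.
  have glueE s : (forall K, K \in s -> K \in T) -> glue s P x =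
      if `[< exists2 K, K \in s & hull K x >] then u x else 0.
    elim: s => [|K s IH] sT /=; first by rewrite asboolF // => -[].
    case: asboolP => [Kx|nKx].
      rewrite (PE K) ?sT ?mem_head // asboolT //.
      by exists K => //; rewrite mem_head.
    rewrite IH; last by move=> K' K's; apply: sT; rewrite inE K's orbT.
    congr (if _ then _ else _); apply: asbool_equiv_eq; split => -[K' K's K'x].
      by exists K' => //; rewrite inE K's orbT.
    exists K' => //; move: K's; rewrite inE => /orP[/eqP KK|//].
    by exfalso; apply: nKx; rewrite -KK.
  by rewrite glueE.
have /choice[dP HdP] : forall K, exists dG : 'I_d -> 'rV[R]_d -> R, K \in T -> forall i,
    continuous (dG i) /\ forall x t,
    is_derive t (1 : R) (fun s : R => P K (x + s *: delta_mx 0 i)) (dG i (x + t *: delta_mx 0 i)).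
  move=> K; have [/Pq/pdeg_partial[_ [dG HG]]|nK] := boolP (K \in T).
    by exists dG.
  by exists (fun _ _ => 0).
have cP K : K \in T -> continuous (P K).
  by move=> KT; have [] := pdeg_partial (Pq K KT).
exists (fun i => glue T (fun K => dP K i)); split => //.
- by rewrite uE; exact: tame_glue.
- by move=> i; apply: tame_glue => // K KT; have [] := HdP K KT i.
- move=> i x; rewrite uE; apply: glue_lines.
  + rewrite -uE => t; apply: (@continuous_comp _ _ _ (fun t : R => x + t *: delta_mx 0 i : 'rV[R]_d)).
      exact: continuous_line.
    exact: c0.
  + by move=> K KT; have [] := HdP K KT i.
  + by move=> K KT t; have [_] := HdP K KT i; exact.
Qed.

End fe_functions.

(** * Weak gradients and the Poincare inequality *)

Section weak_gradients.
Context {R : realType} {d : nat}.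
Local Notation leb n := (@lebesgue_rV R n).
Implicit Types (x : 'rV[R]_d) (phi : 'rV[R]_d -> R).

Lemma smooth_lines phi i x : smooth phi ->
  pwC1 (fun t : R => phi (x + t *: delta_mx 0 i))
       (fun t : R => partial i phi (x + t *: delta_mx 0 i)).
Proof.
move=> sphi; apply: pwC1_C1.
  move=> t; apply: (@continuous_comp _ _ _ (fun t : R => x + t *: delta_mx 0 i : 'rV[R]_d)).
    exact: continuous_line.
  by have [c _] := sphi [:: i]; exact: c.
move=> t; apply/is_derive_line; apply: DeriveDef; last by [].
by have [_ D] := sphi [::]; exact: D.
Qed.

Lemma coord_lines (i : 'I_d) x :
  pwC1 (fun t : R => (x + t *: delta_mx 0 i) 0 i) (fun=> 1).
Proof.
apply: pwC1_C1; first exact: cst_continuous.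
move=> t; under eq_fun do rewrite line_coord eqxx mulr1.
have D := @is_deriveD _ _ _ (cst (x 0 i)) id t (1 : R) 0 1 (is_derive_cst _ _ _) (is_derive_id _ _).
by apply: is_derive_eq; rewrite add0r.
Qed.

Lemma enorm_sqr x : enorm x ^+ 2 = \sum_i x 0 i ^+ 2.
Proof. by rewrite /enorm sqr_sqrtr // sumr_ge0 // => i _; rewrite sqr_ge0. Qed.

Variables (Om : set 'rV[R]_d) (M : R).
Hypotheses (oOm : open Om) (OmM : closure Om `<=` box d M).

Let mOm : measurable Om := open_measurable_rV oOm.

Lemma domain_finite : (leb d Om < +oo)%E.
Proof.
apply: le_lt_trans (@box_finite R d M); apply: le_measure; rewrite ?inE //.
  exact: measurable_box.
by apply: subset_trans OmM; exact: subset_closure.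
Qed.

Lemma integrable_cst_domain (r : R) : (leb d).-integrable Om (cst r%:E).
Proof.
apply/integrableP; split; first exact: measurable_cst.
under eq_integral do rewrite /cst.
rewrite integral_cst // lte_mul_pinfty //; exact: domain_finite.
Qed.

Lemma tame_integrableS (g : 'rV[R]_d -> R) : tame g -> (leb d).-integrable Om (EFin \o g).
Proof. by move=> tg; apply: integrableS (tame_integrable tg). Qed.

Lemma tame_square_integrable (g : 'rV[R]_d -> R) : tame g -> square_integrable Om g.
Proof.
move=> tg; split; first by apply: measurable_funTS; case: tg.
have tg2 : tame (fun x => g x ^+ 2) by under eq_fun do rewrite expr2; exact: tameM_tame.
exact: (integrable_lty mOm (tame_integrableS tg2)).
Qed.

Lemma square_integrable_integrable (g : 'rV[R]_d -> R) : square_integrable Om g ->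
  (leb d).-integrable Om (EFin \o g) /\
  (leb d).-integrable Om (EFin \o (fun x => g x ^+ 2)).
Proof.
move=> [mg g2].
have ig2 : (leb d).-integrable Om (EFin \o (fun x => g x ^+ 2)).
  apply/integrableP; split.
    by apply/measurable_EFinP; exact: measurable_funX.
  by under eq_integral do rewrite /= ger0_norm ?sqr_ge0 //.
split => //.
have i1 : (leb d).-integrable Om (EFin \o (fun x => 1 + g x ^+ 2)).
  have -> : EFin \o (fun x => 1 + g x ^+ 2) =
      (cst 1%E \+ (EFin \o (fun x => (g x ^+ 2)%R)))%E by apply/funext => x.
  by apply: integrableD => //; exact: integrable_cst_domain.
apply: le_integrable i1 => //; first exact/measurable_EFinP.
move=> x _ /=; rewrite lee_fin [leRHS]ger0_norm ?addr_ge0 ?sqr_ge0 //.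
rewrite -(real_normK (num_real (g x))); have := sqr_ge0 (`|g x| - 2^-1).
by move: `|g x| => r; rewrite !expr2; nra.
Qed.

Lemma test_function_bounded phi : test_function Om phi ->
  [/\ continuous phi, exists B, forall x, `|phi x| <= B
    & forall x, ~ Om x -> phi x = 0].
Proof.
move=> [sphi [A [_ AOm phi0]]].
have cphi : continuous phi by have [] := sphi [::].
have [B HB] := continuous_box_bounded M cphi.
have out x : ~ Om x -> phi x = 0 by move=> nO; apply: phi0 => /AOm.
split => //; exists `|B| => x.
have [Ox|/out ->] := pselect (Om x); last by rewrite normr0.
by apply: le_trans (ler_norm B); apply: HB; apply: OmM; exact: subset_closure.
Qed.

(** The difference of two weak gradients is orthogonal to all test functions. *)
Lemma weak_gradient_ae (g w : 'rV[R]_d -> 'rV[R]_d) u :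
  is_weak_gradient Om u g -> is_weak_gradient Om u w ->
  forall i, {ae leb d, forall x, Om x -> g x 0 i = w x 0 i}.
Proof.
move=> [_ ig Hg] [_ iw Hw] i.
have [ig1 _] := square_integrable_integrable (ig i).
have [iw1 _] := square_integrable_integrable (iw i).
have mulphi (h : 'rV[R]_d -> R) phi : test_function Om phi ->
    (leb d).-integrable Om (EFin \o h) ->
    (leb d).-integrable Om (EFin \o (fun x => h x * phi x)).
  move=> /test_function_bounded[cphi [B HB] _] ih.
  have mh : measurable_fun Om h by apply/measurable_EFinP; exact: measurable_int ih.
  apply: (@le_integrable _ _ _ _ _ mOm _ (EFin \o (fun x => B * h x))).
  - apply/measurable_EFinP; apply: measurable_funM => //.
    by apply: measurable_funTS; exact: continuous_measurable_rV.
  - move=> x _ /=; rewrite lee_fin !normrM mulrC ler_wpM2r //.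
    exact: (le_trans (HB x) (ler_norm B)).
  - have -> : EFin \o (fun x => B * h x) = (fun x => B%:E * (EFin \o h) x)%E by apply/funext.
    exact: integrableZl.
have : {ae leb d, forall x, Om x -> g x 0 i - w x 0 i = 0}.
  apply: weak_zero_ae => //.
    have -> : EFin \o (fun x => g x 0 i - w x 0 i) =
       ((EFin \o (fun x => g x 0%R i)) \- (EFin \o (fun x => w x 0%R i)))%E by apply/funext.
    exact: integrableB.
  move=> phi tphi.
  under eq_integral do rewrite mulrBl EFinB.
  rewrite integralB //; [|exact: mulphi|exact: mulphi].
  have fw := integrable_fin_num mOm (mulphi _ _ tphi iw1).
  have := Hw i phi tphi; rewrite (Hg i phi tphi) => /eqP; rewrite eqe_opp => /eqP ->.
  by rewrite subee.
by apply: filterS => x H Ox; apply/eqP; rewrite -subr_eq0; apply/eqP; exact: H.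
Qed.

Variables (u : 'rV[R]_d -> R) (g : 'I_d -> 'rV[R]_d -> R).
Let u0 : 'rV[R]_d -> R := u \_ (closure Om).
Hypotheses (u_bnd : forall x, boundary Om x -> u x = 0)
  (tu : tame u0) (tg : forall i, tame (g i))
  (ug : forall i x, pwC1 (fun t : R => u0 (x + t *: delta_mx 0 i))
                         (fun t : R => g i (x + t *: delta_mx 0 i))).

Let u0_in x : Om x -> u0 x = u x.
Proof. by move=> Ox; rewrite /u0 patchE mem_set //; exact: subset_closure. Qed.

Let u0_out x : ~ Om x -> u0 x = 0.
Proof.
move=> nO; rewrite /u0 patchE; case: ifPn => // /set_mem cx.
by apply: u_bnd; rewrite /boundary ((interior_id _).1 oOm).
Qed.

Let int_u0 (F : 'rV[R]_d -> R) : (forall x, ~ Om x -> F x = 0) ->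
  (\int[leb d]_(x in Om) (F x)%:E = \int[leb d]_x (F x)%:E)%E.
Proof.
move=> F0; rewrite integral_mkcond; apply: eq_integral => x _; rewrite patchE.
by case: ifPn => // /negP nO; rewrite F0 // => Ox; apply: nO; rewrite inE.
Qed.

(** Integration by parts: along lines of direction i, u phi has derivative
g_i phi + u (partial i phi), whose integral vanishes. *)
Lemma is_weak_gradient_lines : is_weak_gradient Om u (fun x => \row_i g i x).
Proof.
have gE i : (fun x => (\row_j g j x) 0 i) = g i by apply/funext => x; rewrite mxE.
split.
- have [m2 i2] := tame_square_integrable tu; split.
    by apply: eq_measurable_fun m2 => x /set_mem Ox; rewrite u0_in.
  by move: i2; under eq_integral => x /set_mem Ox do rewrite u0_in //.
- by move=> i; rewrite gE; exact: tame_square_integrable.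
- move=> i phi tphi; have [cphi [B HB] phi0] := test_function_bounded tphi.
  have sphi := tphi.1.
  have cdphi : continuous (partial i phi) by have [] := sphi [:: i].
  have tF := tameM_cont tu cphi.
  have t1 := tameM_cont (tg i) cphi.
  have t2 := tameM_cont tu cdphi.
  have : (\int[leb d]_x (g i x * phi x + u0 x * partial i phi x)%:E = 0)%E.
    apply: (lines_integral0 (i := i) tF); first exact: tameD.
    by move=> x; apply: pwC1M; [exact: ug|exact: smooth_lines].
  under eq_integral do rewrite EFinD.
  rewrite integralD //; [|exact: tame_integrable|exact: tame_integrable].
  have f1 : (\int[leb d]_x (g i x * phi x)%:E)%E \is a fin_num.
    by apply: integrable_fin_num => //; exact: (tame_integrable t1).
  have f2 : (\int[leb d]_x (u0 x * partial i phi x)%:E)%E \is a fin_num.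
    by apply: integrable_fin_num => //; exact: (tame_integrable t2).
  have -> : (\int[leb d]_(x in Om) (u x * partial i phi x)%:E =
             \int[leb d]_x (u0 x * partial i phi x)%:E)%E.
    rewrite -int_u0; last by move=> x /u0_out ->; rewrite mul0r.
    by apply: eq_integral => x /set_mem Ox; rewrite u0_in.
  have -> : (\int[leb d]_(x in Om) ((\row_j g j x) 0 i * phi x)%:E =
             \int[leb d]_x (g i x * phi x)%:E)%E.
    rewrite -int_u0; last by move=> x /phi0 ->; rewrite mulr0.
    by apply: eq_integral => x _; rewrite mxE.
  move: f1 f2; case: (integral _ _ _) => // a _; case: (integral _ _ _) => // b _.
  by rewrite -EFinD => -[/eqP]; rewrite addrC addr_eq0 => /eqP ->; rewrite EFinN.
Qed.

(** The derivative of u^2 x_i in direction i is 2 x_i u g_i + u^2 and has integral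
zero, while - 2 x_i u g_i <= u^2 / 2 + 2 x_i^2 g_i^2 and |x_i| <= M. *)
Lemma poincare (i : 'I_d) :
  (\int[leb d]_(x in Om) (u x ^+ 2)%:E <=
   (4 * M ^+ 2)%:E * \int[leb d]_(x in Om) (g i x ^+ 2)%:E)%E.
Proof.
pose F x := u0 x * u0 x * x 0 i.
pose G x := (g i x * u0 x + u0 x * g i x) * x 0 i + u0 x * u0 x * 1.
have cc : continuous (fun x : 'rV[R]_d => x 0 i) by exact: coord_continuous.
have tuu := tameM_tame tu tu.
have tF : tame F by exact: tameM_cont.
have tgu : tame (fun x => g i x * u0 x + u0 x * g i x).
  by apply: tameD; exact: tameM_tame.
have tG : tame G.
  apply: tameD; first exact: tameM_cont.
  by under eq_fun do rewrite mulr1.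
have G0 : (\int[leb d]_x (G x)%:E = 0)%E.
  apply: (lines_integral0 (i := i) tF tG) => x.
  apply: (@pwC1M _ (fun t : R => u0 (x + t *: delta_mx 0 i) * u0 (x + t *: delta_mx 0 i))).
    by apply: pwC1M; exact: ug.
  exact: coord_lines.
have tg2 : tame (fun x => g i x ^+ 2) by under eq_fun do rewrite expr2; exact: tameM_tame.
have tu2 : tame (fun x => u0 x ^+ 2) by under eq_fun do rewrite expr2; exact: tameM_tame.
have GOm : (\int[leb d]_(x in Om) (G x)%:E = 0)%E.
  rewrite int_u0 // => x /u0_out E; by rewrite /G E !(mul0r, mulr0, addr0).
have -> : (\int[leb d]_(x in Om) (u x ^+ 2)%:E = \int[leb d]_(x in Om) (u0 x ^+ 2)%:E)%E.
  by apply: eq_integral => x /set_mem Ox; rewrite u0_in.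
have : (\int[leb d]_(x in Om) (2^-1 * u0 x ^+ 2)%:E <=
    \int[leb d]_(x in Om) (G x + 2 * M ^+ 2 * g i x ^+ 2)%:E)%E.
  apply: le_integral => //.
  - apply: (tame_integrableS (g := fun x => 2^-1 * u0 x ^+ 2)).
    by under eq_fun do rewrite mulrC; apply: tameM_cont => //; exact: cst_continuous.
  - apply: (tame_integrableS (g := fun x => G x + 2 * M ^+ 2 * g i x ^+ 2)).
    apply: tameD => //; under eq_fun do rewrite mulrC; apply: tameM_cont => //; exact: cst_continuous.
  - move=> x /set_mem Ox; rewrite lee_fin /G.
    have xM : `|x 0 i| <= M by apply: OmM; exact: subset_closure.
    have x2 : x 0 i ^+ 2 <= M ^+ 2.
      by rewrite -(real_normK (num_real (x 0 i))) lerXn2r ?nnegrE // (le_trans _ xM).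
    have := sqr_ge0 (u0 x + 2 * x 0 i * g i x).
    have : x 0 i ^+ 2 * g i x ^+ 2 <= M ^+ 2 * g i x ^+ 2 by rewrite ler_wpM2r // sqr_ge0.
    rewrite sqrrD; move: (u0 x) (x 0 i) (g i x) => a b c; nra.
under eq_integral do rewrite EFinM.
rewrite integralZl //; last exact: (tame_integrableS tu2).
under [X in (_ <= X)%E -> _]eq_integral do rewrite EFinD EFinM.
rewrite integralD //; last 2 first.
- exact: (tame_integrableS tG).
- by apply: integrableZl => //; exact: (tame_integrableS tg2).
rewrite GOm add0e integralZl //; last exact: (tame_integrableS tg2).
have := integrable_fin_num mOm (tame_integrableS tu2).
have := integrable_fin_num mOm (tame_integrableS tg2).
case: (integral _ _ _) => // a _; case: (integral _ _ _) => // b _.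
rewrite -!EFinM !lee_fin; lra.
Qed.

(** Passes from the piecewise gradient g to the chosen weak gradient, which equals
g almost everywhere. *)
Lemma weak_gradient_norms (i0 : 'I_d) : exists U G : R,
  [/\ 0 <= U, U <= 4 * M ^+ 2 * G,
      is_weak_gradient Om u (weak_gradient Om u),
      (\int[leb d]_(x in Om) (u x ^+ 2)%:E = U%:E)%E
    & (\int[leb d]_(x in Om) (enorm (weak_gradient Om u x) ^+ 2)%:E = G%:E)%E].
Proof.
have wg := is_weak_gradient_lines.
have ww : is_weak_gradient Om u (weak_gradient Om u).
  by rewrite /weak_gradient; apply: (@getPex _ (is_weak_gradient Om u)); eexists; exact: wg.
have [_ iw _] := ww.
have wi i := (square_integrable_integrable (iw i)).2.
have tg2 i : tame (fun x => g i x ^+ 2) by under eq_fun do rewrite expr2; exact: tameM_tame.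
have /choice[a aP] : forall i, exists a : R, 0 <= a /\
    (\int[leb d]_(x in Om) (g i x ^+ 2)%:E = a%:E)%E.
  move=> i; have := integrable_fin_num mOm (tame_integrableS (tg2 i)).
  have : (0 <= \int[leb d]_(x in Om) (EFin \o (fun x => g i x ^+ 2)%R) x)%E.
    by apply: integral_ge0 => x _; rewrite lee_fin sqr_ge0.
  by case: (integral _ _ _) => // r r0 _; exists r.
have awE i : (\int[leb d]_(x in Om) (weak_gradient Om u x 0 i ^+ 2)%:E = (a i)%:E)%E.
  rewrite -(aP i).2; apply: ae_eq_integral => //.
  - exact: measurable_int (wi i).
  - exact: measurable_int (tame_integrableS (tg2 i)).
  - have := weak_gradient_ae wg ww i; apply: filterS => x H Ox.
    by rewrite -(H Ox) mxE.
have [U [U0 UE]] : exists U : R, 0 <= U /\ (\int[leb d]_(x in Om) (u x ^+ 2)%:E = U%:E)%E.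
  have [su _ _] := wg; have := integrable_fin_num mOm (square_integrable_integrable su).2.
  have : (0 <= \int[leb d]_(x in Om) (EFin \o (fun x => u x ^+ 2)%R) x)%E.
    by apply: integral_ge0 => x _; rewrite lee_fin sqr_ge0.
  by case: (integral _ _ _) => // r r0 _; exists r.
exists U, (\sum_i a i); split => //.
  have := poincare i0; rewrite UE (aP i0).2 -EFinM lee_fin => /le_trans; apply.
  apply: ler_wpM2l; first by rewrite mulr_ge0 ?sqr_ge0.
  rewrite (bigD1 i0) //= lerDl.
  by apply: sumr_ge0 => i _; have [] := aP i.
under eq_integral do rewrite enorm_sqr -sumEFin.
rewrite ge0_integral_sum //.
- by rewrite -sumEFin; apply: eq_bigr => i _; exact: awE.
- by move=> i; exact: measurable_int (wi i).
- by move=> i x _; rewrite lee_fin sqr_ge0.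
Qed.

End weak_gradients.

(** * The nodal interpolant *)

Section interpolation.
Context {R : realType} {d : nat}.
Variables (Om : set 'rV[R]_d) (T : {fset simplex R d}) (q : nat).
Implicit Types (u w : 'rV[R]_d -> R) (x z : 'rV[R]_d).

Lemma fe_space0 : fe_space Om T q (fun=> 0).
Proof.
split => //; first by apply: continuous_subspaceT => x; exact: cst_continuous.
move=> K _; exists (fun=> 0) => //; exists (fun=> 0) => x.
by rewrite big1 // => a _; rewrite mul0r.
Qed.

Lemma fe_spaceDZ u w (c : R) : fe_space Om T q u -> fe_space Om T q w ->
  fe_space Om T q (fun x => u x + c * w x).
Proof.
move=> [cu pu bu] [cw p_w bw]; split.
- move=> x; apply: (@continuousD _ _ (subspace (closure Om)) u (fun x => c * w x)).
    exact: cu.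
  apply: (@continuousM _ (subspace (closure Om)) (cst c) w); last exact: cw.
  exact: cst_continuous.
- move=> K KT; have [p [cp pE] uE] := pu K KT; have [r [cr rE] wE] := p_w K KT.
  exists (fun x => p x + c * r x); last by move=> x Kx; rewrite uE // wE.
  exists (fun a => cp a + c * cr a) => x; rewrite pE rE mulr_sumr -big_split /=.
  by apply: eq_bigr => a _; rewrite mulrDl mulrA.
- by move=> x bx; rewrite bu // bw // mulr0 addr0.
Qed.

Lemma fe_space_sum (s : seq 'rV[R]_d) (c : 'rV[R]_d -> R) (Phi : 'rV[R]_d -> 'rV[R]_d -> R) :
  (forall z, fe_space Om T q (Phi z)) ->
  fe_space Om T q (fun x => \sum_(z <- s) c z * Phi z x).
Proof.
move=> HPhi; elim: s => [|z s IH].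
  by under eq_fun do rewrite big_nil; exact: fe_space0.
under eq_fun do rewrite big_cons addrC.
exact: fe_spaceDZ.
Qed.

(** A chosen basis function is zero when no finite element function has the nodal
property; b tells the two cases apart. *)
Lemma nodal_basis_cases z : fe_space Om T q (nodal_basis Om T q z) /\
  exists b : bool, forall z', lagrange_nodes Om T q z' ->
    nodal_basis Om T q z z' = (b && (z' == z))%:R.
Proof.
rewrite /nodal_basis; set A := [set phi | _].
have [[phi Aphi]|nA] := pselect (exists phi, A phi).
  have [fe dl] : A (get A) by exact: (getPex (ex_intro _ phi Aphi)).
  by split => //; exists true.
rewrite getPN; last by move=> phi Aphi; apply: nA; exists phi.
by split; [exact: fe_space0|exists false].
Qed.

Lemma finite_lagrange_nodes : finite_set (lagrange_nodes Om T q).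
Proof.
pose pt (K : simplex R d) (a : {ffun 'I_d.+1 -> 'I_q.+1}) : 'rV[R]_d :=
  \sum_i ((a i)%:R / q%:R) *: K i.
apply: (@sub_finite_set _ _ [set` flatten [seq [seq pt K a | a <- enum {ffun 'I_d.+1 -> 'I_q.+1}] | K <- T]]).
  move=> z [_ [K KT [a [aq zE]]]] /=; apply/flattenP.
  exists [seq pt K a | a <- enum {ffun 'I_d.+1 -> 'I_q.+1}].
    by apply/mapP; exists K.
  have aqi i : (a i < q.+1)%N by rewrite ltnS -aq (bigD1 i) //= leq_addr.
  apply/mapP; exists [ffun i => Ordinal (aqi i)]; first by rewrite mem_enum.
  by rewrite zE; apply: eq_bigr => i _; rewrite ffunE.
exact: finite_seq.
Qed.

Lemma interpolantE u : interpolant Om T q u =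
  fun x => \sum_(z <- fset_set (lagrange_nodes Om T q)) u z * nodal_basis Om T q z x.
Proof.
apply/funext => x; rewrite /interpolant fsbig_finite //; exact: finite_lagrange_nodes.
Qed.

Lemma interpolant_fe u : fe_space Om T q (interpolant Om T q u).
Proof.
by rewrite interpolantE; apply: fe_space_sum => z; have [] := nodal_basis_cases z.
Qed.

(** The factor b z does not depend on u.  At a node, the interpolants of f v and of
v therefore differ by the factor f z, whatever b z is. *)
Lemma interpolant_node : exists b : 'rV[R]_d -> bool, forall u z,
  lagrange_nodes Om T q z -> interpolant Om T q u z = (b z)%:R * u z.
Proof.
have /choice[b HB] : forall z, exists b : bool, forall z', lagrange_nodes Om T q z' ->
    nodal_basis Om T q z z' = (b && (z' == z))%:R.
  by move=> z; have [] := nodal_basis_cases z.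
exists b => u z nz; rewrite interpolantE.
have zin : z \in fset_set (lagrange_nodes Om T q).
  by rewrite in_fset_set ?inE //; exact: finite_lagrange_nodes.
rewrite (big_rem z) //= HB // eqxx andbT mulrC big1_seq ?addr0 // => z' /andP[_ z'r].
rewrite HB // (_ : (z == z') = false) ?andbF ?mulr0 //.
apply/negbTE; apply: contraTneq z'r => <-; rewrite mem_rem_uniq ?inE ?eqxx //.
exact: fset_uniq.
Qed.

End interpolation.

(** * Estimates on one simplex *)

Section element_estimate.
Context {R : realType}.
Local Notation leb n := (@lebesgue_rV R n).

Lemma compact_hull d (K : simplex R d) : Defs.nondegenerate K -> compact (hull K).
Proof.
move=> uK; have [M HM] := hull_bounded K.
apply: (@subclosed_compact _ _ (closed_box (\row_(i < d) - M) (\row_(i < d) M))).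
- exact: closed_face.
- exact: compact_closed_box.
- by move=> x /HM xM i; rewrite !mxE -ler_norml.
Qed.

Definition lattice_point d (K : simplex R d) q (a : 'I_d.+1 -> nat) : 'rV[R]_d :=
  \sum_i ((a i)%:R / q%:R) *: K i.

(** An affine map A carries the lattice points c with |c| <= q to the lattice points
of K, so the constant of the reference lattice serves for all K. *)
Lemma hull_lattice_bound d q : (0 < q)%N -> exists2 Lam : R, 0 <= Lam &
  forall (K : simplex R d) G m, pdeg q G ->
    (forall a : 'I_d.+1 -> nat, (\sum_i a i)%N = q -> `|G (lattice_point K q a)| <= m) ->
  forall x, hull K x -> `|G x| <= Lam * m.
Proof.
move=> q0; have [Lam L0 HL] := @lattice_bound R d q; exists Lam => // K G m Gq Gm x.
have qR0 : q%:R != 0 :> R by rewrite pnatr_eq0 -lt0n.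
pose A (t : 'rV[R]_d) : 'rV[R]_d :=
  K ord0 + \sum_i (t 0 i / q%:R) *: (K (lift ord0 i) - K ord0).
(* A t is the point of K with barycentric coordinates t i / q at the vertices
   of positive index. *)
have AE (lam : 'I_d.+1 -> R) (t : 'rV[R]_d) : \sum_j lam j = 1 ->
    (forall i, t 0 i / q%:R = lam (lift ord0 i)) -> \sum_j lam j *: K j = A t.
  move=> s1 tE; rewrite /A; under [in RHS]eq_bigr do rewrite tE scalerBr.
  rewrite sumrB -scaler_suml big_ord_recl.
  have -> : \sum_i lam (lift ord0 i) = 1 - lam ord0.
    by rewrite -s1 big_ord_recl addrC addKr.
  rewrite scalerBl scale1r opprB addrCA addrC; congr (_ + _).
  by rewrite addrC subrK.
have Aaff i : exists (c : R) (B : 'I_d -> R), forall t, A t 0 i = c + \sum_j B j * t 0 j.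
  exists (K ord0 0 i), (fun j => (K (lift ord0 j) - K ord0) 0 i / q%:R) => t.
  rewrite /A mxE summxE; congr (_ + _); apply: eq_bigr => j _.
  by rewrite mxE; field.
move=> [lam [l0 _ s1 ->]].
pose t : 'rV[R]_d := \row_i (q%:R * lam (lift ord0 i)).
rewrite (AE lam t s1); last by move=> i; rewrite mxE mulrC mulKf.
apply: (HL (fun t => G (A t))); first exact: pdeg_comp_affine.
  move=> i; rewrite mxE mulr_ge0 //= ler_piMr // -s1 (bigD1 (lift ord0 i)) //= lerDl.
  by apply: sumr_ge0.
move=> c cq.
pose a (j : 'I_d.+1) : nat := if unlift ord0 j is Some i then c i else (q - \sum_i c i)%N.
have aq : (\sum_j a j)%N = q.
  rewrite big_ord_recl (_ : a ord0 = q - \sum_i c i)%N; last by rewrite /a unlift_none.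
  rewrite (_ : \sum_(i < d) a (lift ord0 i) = \sum_i c i)%N; first by rewrite subnK.
  by apply: eq_bigr => i _; rewrite /a liftK.
have := Gm a aq; rewrite /lattice_point (AE _ (\row_i (c i)%:R)) //.
  by rewrite -mulr_suml -natr_sum aq divff.
by move=> i; rewrite mxE /a liftK.
Qed.

(** Let |G| be maximal on K at x0, with maximum m.  Along the segments from x0 the
restriction of G is a polynomial of degree at most q bounded by m, so by
[markov_half] it stays above m / 2 for a fraction delta of the way.  The
corresponding homothetic image of K has volume delta^d |K|, and there
G^2 >= m^2 / 4. *)
Lemma hull_inverse_estimate d q : (0 < q)%N -> exists2 C : R, 0 <= C &
  forall (K : simplex R d) G, Defs.nondegenerate K -> pdeg q G ->
  exists2 m, forall x, hull K x -> `|G x| <= m &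
    ((m ^+ 2)%:E * leb d (hull K) <= C%:E * \int[leb d]_(x in hull K) (G x ^+ 2)%:E)%E.
Proof.
move=> q0; have [delta /andP[d0 d1] Hd] := @markov_half R q q0.
exists (4 * (delta^-1) ^+ d); first by rewrite mulr_ge0 // exprn_ge0 // invr_ge0 ltW.
move=> K G uK Gq.
have [cG _] := pdeg_partial Gq.
have mK : measurable (hull K) by exact: measurable_face.
have [x0 Kx0 x0max] : exists2 x0, hull K x0 & forall x, hull K x -> `|G x| <= `|G x0|.
  have [|||x0 /set_mem Kx0 H] := @EVT_max_rV _ _ (fun x => `|G x|) (hull K).
  - by exists (K ord0); exact: hull_vertex.
  - exact: compact_hull.
  - apply: continuous_subspaceT => x.
    by apply: (@continuous_comp _ _ _ G (fun r : R => `|r|)); [exact: cG|exact: norm_continuous].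
  - by exists x0 => // x Kx; apply: H; exact: mem_set.
exists `|G x0| => //; set m := `|G x0|.
(* K' is the image of K under x |-> x0 + delta (x - x0), written as the
   preimage under the inverse homothety. *)
pose c := x0 - delta^-1 *: x0.
pose K' := (fun x : 'rV[R]_d => c + delta^-1 *: x) @^-1` hull K.
have mK' : measurable K'.
  by rewrite -[K']setTI; apply: measurable_homothety.
have di0 : 0 < delta^-1 by rewrite invr_gt0.
have volK := lebesgue_rV_homothety c di0 mK.
have K'E x : K' x -> exists2 y, hull K y & x = x0 + delta *: (y - x0).
  move=> K'x; exists (c + delta^-1 *: x) => //.
  by rewrite /c; apply/rowP => i; rewrite !mxE; field; rewrite gt_eqF.
have K'sub : K' `<=` hull K.
  move=> x /K'E[y Ky ->].
  have -> : x0 + delta *: (y - x0) = (1 - delta) *: x0 + delta *: y.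
    by rewrite scalerBr scalerBl scale1r addrA addrAC.
  by apply: hull_convex => //; rewrite ltW.
have low x : K' x -> m / 2 <= `|G x|.
  move=> /K'E[y Ky ->].
  have [p sp pE] := pdeg_line x0 (y - x0) Gq.
  have pm s : 0 <= s <= 1 -> `|p.[s]| <= m.
    move=> s01; rewrite -pE; apply: x0max.
    have -> : x0 + s *: (y - x0) = (1 - s) *: x0 + s *: y.
      by rewrite scalerBr scalerBl scale1r addrA addrAC.
    exact: hull_convex.
  have := Hd p m sp pm delta; rewrite lexx ltW // => /(_ isT).
  rewrite -!pE scale0r addr0 => H.
  have := ler_distD (G (x0 + delta *: (y - x0))) (G x0) 0.
  rewrite !subr0 -/m (distrC (G x0)) => H2; lra.
have mG2 : measurable_fun setT (fun x => (G x ^+ 2)%:E).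
  apply/measurable_EFinP; apply: measurable_funX; exact: continuous_measurable_rV.
have step : (((m / 2) ^+ 2)%:E * leb d K' <= \int[leb d]_(x in hull K) (G x ^+ 2)%:E)%E.
  apply: (@le_trans _ _ (\int[leb d]_(x in K') (G x ^+ 2)%:E)%E); last first.
    apply: ge0_subset_integral => //; first exact: measurable_funTS.
    by move=> x _; rewrite lee_fin sqr_ge0.
  rewrite -integral_cst //; apply: ge0_le_integral => //.
  - by move=> x _; rewrite lee_fin sqr_ge0.
  - exact: measurable_funTS.
  - move=> x K'x; rewrite lee_fin -(real_normK (num_real (G x))).
    by rewrite lerXn2r ?nnegrE ?divr_ge0 ?normr_ge0 //; exact: low.
rewrite -volK -/K' muleA -EFinM.
have -> : m ^+ 2 * delta^-1 ^+ d = (4 * delta^-1 ^+ d) * (m / 2) ^+ 2.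
  by rewrite !expr2; field.
rewrite EFinM -muleA lee_pmul2l // lte_fin mulr_gt0 // exprn_gt0 //.
Qed.

(** The values of W at the lattice points are at most F sup |U|, so sup |W| is at
most a constant times F sup |U|; then sup |U| is traded for the L2 norm. *)
Lemma element_estimate d q : (0 < q)%N -> exists2 C : R, 0 <= C &
  forall (K : simplex R d) (U W : 'rV[R]_d -> R) F, Defs.nondegenerate K ->
    pdeg q U -> pdeg q W -> 0 <= F ->
    (forall a : 'I_d.+1 -> nat, (\sum_i a i)%N = q ->
       `|W (lattice_point K q a)| <= F * `|U (lattice_point K q a)|) ->
  (\int[leb d]_(x in hull K) (W x ^+ 2)%:E <=
   (C * F ^+ 2)%:E * \int[leb d]_(x in hull K) (U x ^+ 2)%:E)%E.
Proof.
move=> q0; have [Lam L0 HL] := hull_lattice_bound d q0.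
have [C C0 HC] := hull_inverse_estimate d q0.
exists (Lam ^+ 2 * C); first by rewrite mulr_ge0 // exprn_ge0.
move=> K U W F uK Uq Wq F0 WU.
have [m Um mE] := HC K U uK Uq.
have mK : measurable (hull K) by exact: measurable_face.
have lat a : (\sum_i a i)%N = q -> hull K (lattice_point K q a).
  move=> aq; exists (fun i => (a i)%:R / q%:R); split => //.
  - by move=> i; rewrite inE.
  - by rewrite -mulr_suml -natr_sum aq divff // pnatr_eq0 -lt0n.
have Wm x : hull K x -> `|W x| <= Lam * (F * m).
  apply: HL => // a aq; apply: (le_trans (WU a aq)).
  by rewrite ler_wpM2l // Um //; exact: lat.
have [cW _] := pdeg_partial Wq.
have m0 : 0 <= m by apply: (le_trans _ (Um (K ord0) (hull_vertex K ord0))).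
apply: (@le_trans _ _ ((((Lam * F) * m) ^+ 2)%:E * leb d (hull K))%E).
  rewrite -integral_cst //; apply: ge0_le_integral => //.
  - by move=> x _; rewrite lee_fin sqr_ge0.
  - apply: measurable_funTS; apply/measurable_EFinP; apply: measurable_funX; exact: continuous_measurable_rV.
  - move=> x Kx; rewrite lee_fin -(real_normK (num_real (W x))).
    rewrite lerXn2r ?nnegrE ?mulr_ge0 ?normr_ge0 // -mulrA; exact: Wm.
rewrite exprMn EFinM -muleA.
have -> : (Lam ^+ 2 * C * F ^+ 2) = (Lam * F) ^+ 2 * C by rewrite exprMn; ring.
rewrite [X in (_ <= X * _)%E]EFinM -[leRHS]muleA; apply: lee_wpmul2l => //.
by rewrite lee_fin sqr_ge0.
Qed.

End element_estimate.

(** * Summation over a triangulation *)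

Section triangulation_sum.
Context {R : realType} {d : nat}.
Local Notation leb n := (@lebesgue_rV R n).

Lemma ge0_integral_setU_null (A B : set 'rV[R]_d) (h : 'rV[R]_d -> R) :
  measurable A -> measurable B -> measurable_fun setT h -> (forall x, 0 <= h x) ->
  leb d (A `&` B) = 0%E ->
  (\int[leb d]_(x in A `|` B) (h x)%:E =
   \int[leb d]_(x in A) (h x)%:E + \int[leb d]_(x in B) (h x)%:E)%E.
Proof.
move=> mA mB mh h0 AB0.
have mhE D : measurable_fun D (fun x => (h x)%:E).
  by apply: measurable_funTS; exact/measurable_EFinP.
have mAB : measurable (A `&` B) by exact: measurableI.
rewrite [X in (_ + X)%E](ge0_negligible_integral mAB) //; last by move=> x _; rewrite lee_fin.
have DE : B `\` (A `&` B) = B `\` A.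
  by apply/seteqP; split => x [Bx nx]; split => // h1; apply: nx => //; case: h1.
have mBA : measurable (B `\` A) by exact: measurableD.
have -> : A `|` B = A `|` (B `\` A).
  apply/seteqP; split => x [Ax|Bx]; [by left| |by left|by case: Bx; right].
  by have [Ax|nAx] := pselect (A x); [left|right].
rewrite DE ge0_integral_setU //; first by move=> x _; rewrite lee_fin.
by apply/disj_setPS => x [Ax []].
Qed.

(** The carrier of a list of simplices, which unlike that of a finite set can be
built one simplex at a time. *)
Definition region (s : seq (simplex R d)) : set 'rV[R]_d :=
  [set x | exists2 K, K \in s & hull K x].

Lemma region_cons K s : region (K :: s) = hull K `|` region s.
Proof.
apply/seteqP; split => x.
  by move=> [K']; rewrite inE => /orP[/eqP ->|K's K'x]; [left|right; exists K'].
by move=> [Kx|[K' K's K'x]]; [exists K; rewrite ?mem_head|exists K'; rewrite ?inE ?K's ?orbT].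
Qed.

Lemma region_nil : region [::] = set0.
Proof. by apply/seteqP; split => x // -[]. Qed.

Lemma measurable_region s : (forall K, K \in s -> Defs.nondegenerate K) ->
  measurable (region s).
Proof.
elim: s => [|K s IH] nd; first by rewrite region_nil.
rewrite region_cons; apply: measurableU.
  by apply: measurable_face; apply: nd; rewrite mem_head.
by apply: IH => K' K's; apply: nd; rewrite inE K's orbT.
Qed.

(** Adding one simplex K at a time: by conformity K meets every other simplex in one
of its faces, so either this face is K itself, and K adds nothing to a region
that contains the other simplex, or it is a null set, and the integrals add
up. *)
Lemma conforming_integral_le (T : {fset simplex R d}) (u w : 'rV[R]_d -> R) (C : R) :
  (0 < d)%N -> 0 <= C -> (forall K, K \in T -> Defs.nondegenerate K) -> conforming T ->
  measurable_fun setT u -> measurable_fun setT w ->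
  (forall K, K \in T -> (\int[leb d]_(x in hull K) (w x ^+ 2)%:E <=
     C%:E * \int[leb d]_(x in hull K) (u x ^+ 2)%:E)%E) ->
  (\int[leb d]_(x in carrier T) (w x ^+ 2)%:E <=
   C%:E * \int[leb d]_(x in carrier T) (u x ^+ 2)%:E)%E.
Proof.
move=> d0 C0 nd cf mu mw est.
have mV s : (forall K, K \in s -> K \in T) -> measurable (region s).
  by move=> sT; apply: measurable_region => K /sT; exact: nd.
suff H s : (forall K, K \in s -> K \in T) ->
    (\int[leb d]_(x in region s) (w x ^+ 2)%:E <= C%:E * \int[leb d]_(x in region s) (u x ^+ 2)%:E)%E.
  exact: H.
elim: s => [|K s IH] sT.
  by rewrite region_nil !integral_set0 mule0.
have sT' K' : K' \in s -> K' \in T by move=> K's; apply: sT; rewrite inE K's orbT.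
have KT : K \in T by apply: sT; rewrite mem_head.
have mK : measurable (hull K) by apply: measurable_face; exact: nd.
have [KV|nKV] := pselect (hull K `<=` region s).
  by rewrite region_cons (setUidPr _ _).2 //; exact: IH.
have null : leb d (hull K `&` region s) = 0%E.
  have : forall s', (forall K', K' \in s' -> K' \in s) -> leb d (hull K `&` region s') = 0%E.
    elim=> [|K' s' IH'] s's.
      by rewrite region_nil setI0 measure0.
    have K's : K' \in s by apply: s's; rewrite mem_head.
    have s's' K'' : K'' \in s' -> K'' \in s by move=> h; apply: s's; rewrite inE h orbT.
    have mV' : measurable (region s') by apply: mV => K'' /s's'; exact: sT'.
    have mK' : measurable (hull K') by apply: measurable_face; apply: nd; exact: sT'.
    have [I [J [IE _]]] := cf K K' KT (sT' K' K's).
    have n1 : leb d (hull K `&` hull K') = 0%E.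
      rewrite IE; apply: face_null => //; first exact: nd.
      apply/eqP => IT; apply: nKV => x Kx; exists K' => //.
      by have : (hull K `&` hull K') x; [rewrite IE IT|case].
    apply/eqP; rewrite -measure_le0 region_cons setIUr.
    have m1 := measurableI _ _ mK mK'; have m2 := measurableI _ _ mK mV'.
    apply: (@le_trans _ _ (leb d (hull K `&` hull K') + leb d (hull K `&` region s'))%E).
      exact: measureU2.
    by rewrite n1 IH' // adde0.
  exact.
have mu2 : measurable_fun setT (fun x => u x ^+ 2) by exact: measurable_funX.
have mw2 : measurable_fun setT (fun x => w x ^+ 2) by exact: measurable_funX.
rewrite region_cons !ge0_integral_setU_null //; try (by move=> x; exact: sqr_ge0); try exact: mV.
rewrite ge0_muleDr; try by apply: integral_ge0 => x _; rewrite lee_fin sqr_ge0.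
by apply: leeD; [exact: est|exact: IH].
Qed.

End triangulation_sum.

(** * Stability *)

Section stability.
Context {R : realType} {d : nat}.
Local Notation leb n := (@lebesgue_rV R n).

Lemma closed_domain_box (Om : set 'rV[R]_d) : bounded_set Om ->
  exists2 M, 0 <= M & closure Om `<=` box d M.
Proof.
move=> [M [_ HM]]; exists (`|M| + 1); first by rewrite addr_ge0.
have cb : closed (box d (`|M| + 1)).
  rewrite (_ : box d _ = \bigcap_(i : 'I_d) ((fun x : 'rV[R]_d => x 0 i) @^-1` [set t | `|t| <= `|M| + 1])).
    apply: closed_bigI => i _; apply: closed_comp => [x _|].
      exact: coord_continuous.
    rewrite (_ : [set t | _] = (fun t : R => `|t|) @^-1` [set t | t <= `|M| + 1]) //.
    apply: closed_comp => [x _|]; [exact: norm_continuous|exact: closed_le].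
  by apply/seteqP; split => x H i => [_|]; exact: H.
rewrite [box d _]((closure_id _).1 cb); apply: closure_subset => x Ox i.
have := HM (`|M| + 1) _ x Ox; rewrite (le_lt_trans (ler_norm M)) ?ltrDl // => /(_ isT).
apply: le_trans; rewrite /Num.Def.normr /= mx_normrE.
exact: (le_bigmax _ (fun ij : 'I_1 * 'I_d => `|x ij.1 ij.2|) (0, i)).
Qed.

Lemma continuous_closure_bounded (Om : set 'rV[R]_d) M (f : 'rV[R]_d -> R) :
  closure Om `<=` box d M -> {within closure Om, continuous f} ->
  exists2 F, 0 <= F & forall x, closure Om x -> `|f x| <= F.
Proof.
move=> OmM cf.
have cc : compact (closure Om).
  apply: (@subclosed_compact _ _ (closed_box (\row_(i < d) - M) (\row_(i < d) M))).
  - exact: closed_closure.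
  - exact: compact_closed_box.
  - by move=> x /OmM xM i; rewrite !mxE -ler_norml.
have [B [_ HB]] := compact_bounded (continuous_compact cf cc).
exists (`|B| + 1); first by rewrite addr_ge0.
move=> x cx; apply: (HB (`|B| + 1)); last by exists x.
by apply: (le_lt_trans (ler_norm B)); rewrite ltrDl.
Qed.

(** At a lattice point on the boundary both interpolants vanish; elsewhere the one
of f v is f times the one of v.  So [element_estimate] applies on each simplex
with F a bound for |f|, and the estimates add up. *)
Lemma interpolant_L2_stability q : (0 < d)%N -> (0 < q)%N -> exists2 C : R, 0 <= C &
  forall (Om : set 'rV[R]_d) M (T : {fset simplex R d}) (f v : 'rV[R]_d -> R) F,
    open Om -> closure Om `<=` box d M -> triangulation Om T -> 0 <= F ->
    (forall x, closure Om x -> `|f x| <= F) ->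
  (\int[leb d]_(x in Om) (interpolant Om T q (f \* v)%R x ^+ 2)%:E <=
   (C * F ^+ 2)%:E * \int[leb d]_(x in Om) (interpolant Om T q v x ^+ 2)%:E)%E.
Proof.
move=> d0 q0; have [C C0 HC] := @element_estimate R d q q0; exists C => //.
move=> Om M T f v F oOm OmM [nd cf cT] F0 fF.
set u := interpolant Om T q v; set w := interpolant Om T q (f \* v).
have fu : fe_space Om T q u by exact: interpolant_fe.
have fw : fe_space Om T q w by exact: interpolant_fe.
have [PU Uq UE] := fe_pieces fu; have [PW Wq WE] := fe_pieces fw.
have [_ [_ tu _ _]] := fe_gradient oOm nd cT fu.
have [_ [_ tw _ _]] := fe_gradient oOm nd cT fw.
have mOm := open_measurable_rV oOm.
have mcl : measurable (closure Om) by apply: closed_measurable_rV; exact: closed_closure.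
set u0 := u \_ (closure Om) in tu; set w0 := w \_ (closure Om) in tw.
have clK K x : K \in T -> hull K x -> closure Om x by move=> KT Kx; rewrite -cT; exists K.
have u0E x : closure Om x -> u0 x = u x by move=> cx; rewrite /u0 patchE mem_set.
have w0E x : closure Om x -> w0 x = w x by move=> cx; rewrite /w0 patchE mem_set.
have mu0 : measurable_fun setT u0 by case: tu.
have mw0 : measurable_fun setT w0 by case: tw.
have : (\int[leb d]_(x in carrier T) (w0 x ^+ 2)%:E <=
    (C * F ^+ 2)%:E * \int[leb d]_(x in carrier T) (u0 x ^+ 2)%:E)%E.
  apply: conforming_integral_le => //; first by rewrite mulr_ge0 // sqr_ge0.
  move=> K KT.
  rewrite (eq_integral (fun x => (PW K x ^+ 2)%:E)); last first.
    by move=> x /set_mem Kx; rewrite (w0E x (clK K x KT Kx)) (WE K x KT Kx).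
  rewrite [in leRHS](eq_integral (fun x => (PU K x ^+ 2)%:E)); last first.
    by move=> x /set_mem Kx; rewrite (u0E x (clK K x KT Kx)) (UE K x KT Kx).
  apply: HC => //; [exact: nd|exact: Uq|exact: Wq|].
  move=> a aq; set z := lattice_point K q a.
  have Kz : hull K z.
    exists (fun i => (a i)%:R / q%:R); split => //.
    - by move=> i; rewrite inE.
    - by rewrite -mulr_suml -natr_sum aq divff // pnatr_eq0 -lt0n.
  rewrite -(WE K) // -(UE K) //.
  have [bz|nbz] := pselect (boundary Om z).
    have [_ _ bw] := fw; have [_ _ bu] := fu.
    by rewrite bw // bu // normr0 mulr0.
  have [b Hb] := interpolant_node Om T q.
  have nz : lagrange_nodes Om T q z by split => //; exists K => //; exists a.
  rewrite /w /u !Hb // mulrCA normrM ler_wpM2r //; apply: fF; exact: clK Kz.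
rewrite cT => H.
apply: (@le_trans _ _ (\int[leb d]_(x in closure Om) (w0 x ^+ 2)%:E)%E).
  rewrite (eq_integral (fun x => (w0 x ^+ 2)%:E)); last first.
    by move=> x /set_mem Ox; rewrite w0E //; exact: subset_closure.
  apply: ge0_subset_integral => //; last exact: subset_closure.
    by apply: measurable_funTS; apply/measurable_EFinP; exact: measurable_funX.
  by move=> x _; rewrite lee_fin sqr_ge0.
apply: (le_trans H); rewrite le_eqVlt; apply/orP; left; apply/eqP; congr (_ * _)%E.
rewrite integral_mkcond [RHS]integral_mkcond; apply: eq_integral => x _; rewrite !patchE.
case: ifPn => [/set_mem cx|ncx]; last first.
  by rewrite ifN //; apply: contra ncx => /set_mem Ox; apply: mem_set; exact: subset_closure.
rewrite u0E //; case: ifPn => // /negP nO.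
have [_ _ bu] := fu; rewrite bu ?expr0n //.
by rewrite /boundary ((interior_id _).1 oOm); split => // Ox; apply: nO; rewrite inE.
Qed.

End stability.

Theorem proposition2p1 (R : realType) (d : nat) (d_range : (1 <= d <= 3)%N)
  (Omega : set 'rV[R]_d) (Omega_polygonal : polygonal_domain Omega)
  (arch : nat -> nn_architecture R)
  (T : nat -> {fset simplex R d})
  (T_triangulation : forall l, triangulation Omega (T l))
  (T_size : mesh_size (T l) @[l --> \oo] --> (0 : R))
  (T_regular : shape_regular T)
  (q : nat) (q_gt0 : (1 <= q)%N)
  (f : 'rV[R]_d -> R) (f_continuous : {within closure Omega, continuous f})
  (v : nat -> 'rV[R]_d -> R) (v_nn : forall l, nn_space (arch l) Omega (v l))
  (C : R) (C_gt0 : 0 < C)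
  (energy_le : forall l,
    (energy Omega (T l) q f (v l) <= C%:E)%E) :
  exists2 C1 : R, 0 < C1 & forall l,
    (H1norm Omega (interpolant Omega (T l) q (v l)) <= C1%:E)%E.
Proof.
have d0 : (0 < d)%N by case/andP: d_range.
have [_ _ bOm [T0 [_ OmE]]] := Omega_polygonal.
have oOm : open Omega by rewrite OmE; exact: open_interior.
have mOm := open_measurable_rV oOm.
have [M M0 OmM] := closed_domain_box bOm.
have [F F0 fF] := continuous_closure_bounded OmM f_continuous.
have [C2 C20 HC2] := @interpolant_L2_stability R d q d0 q_gt0.
have volfin : (@lebesgue_rV R d) Omega \is a fin_num.
  by rewrite ge0_fin_numE //; exact: (domain_finite oOm OmM).
pose V : R := fine ((@lebesgue_rV R d) Omega).
have VE : (@lebesgue_rV R d) Omega = V%:E by rewrite fineK.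
have V0 : 0 <= V by rewrite fine_ge0.
pose CP := 4 * M ^+ 2; have CP0 : 0 <= CP by rewrite mulr_ge0 // sqr_ge0.
pose D := C2 * F ^+ 2; have D0 : 0 <= D by rewrite mulr_ge0 // sqr_ge0.
pose k := D * CP + 1; have k1 : 1 <= k by rewrite lerDr mulr_ge0.
pose B := 4 * C + 4 * V * k.
have B0 : 0 <= B by rewrite addr_ge0 // ?mulr_ge0 // ltW // (lt_le_trans _ k1).
exists (powR ((1 + CP) * B) 2^-1 + 1).
  by rewrite ltr_wpDl // powR_ge0.
move=> l; have [nd cf cT] := T_triangulation l.
set u := interpolant Omega (T l) q (v l).
pose w := interpolant Omega (T l) q (f \* v l).
have fu : fe_space Omega (T l) q u by exact: interpolant_fe.
have fw : fe_space Omega (T l) q w by exact: interpolant_fe.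
have [g [_ tu tg ug]] := fe_gradient oOm nd cT fu.
have [_ [_ tw _ _]] := fe_gradient oOm nd cT fw.
have [_ _ bu] := fu.
have [U [G [U0 UG wg UE GE]]] := weak_gradient_norms oOm OmM bu tu tg ug (Ordinal d0).
set gw := weak_gradient Omega u in wg GE.
have WU := HC2 Omega M (T l) f (v l) F oOm OmM (T_triangulation l) F0 fF.
have sw : square_integrable Omega w.
  have [m2 i2] := tame_square_integrable oOm tw.
  have wE x : x \in Omega -> (w \_ (closure Omega)) x = w x.
    by move=> /set_mem Ox; rewrite patchE mem_set //; exact: subset_closure.
  split; first by apply: eq_measurable_fun m2.
  by move: i2; under eq_integral => x Ox do rewrite wE //.
have [iw iw2] := square_integrable_integrable oOm OmM sw.
have [W WE] : exists W : R, (\int[@lebesgue_rV R d]_(x in Omega) (w x ^+ 2)%:E = W%:E)%E.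
  by have := integrable_fin_num mOm iw2; case: (integral _ _ _) => // r _; exists r.
have [omega omegaE] : exists o : R, (\int[@lebesgue_rV R d]_(x in Omega) (w x)%:E = o%:E)%E.
  by have := integrable_fin_num mOm iw; case: (integral _ _ _) => // r _; exists r.
have WDU : W <= D * U.
  by move: WU; rewrite -/u -/w UE WE -EFinM lee_fin.
have [su sg _] := wg.
have ig : (@lebesgue_rV R d).-integrable Omega (EFin \o (fun x => enorm (gw x) ^+ 2)).
  have -> : EFin \o (fun x => enorm (gw x) ^+ 2) =
      (fun x => \sum_(i < d) (gw x 0%R i ^+ 2)%:E)%E.
    by apply/funext => x /=; rewrite enorm_sqr sumEFin.
  apply: integrable_sum => // i _.
  exact: (square_integrable_integrable oOm OmM (sg i)).2.
have E : (energy Omega (T l) q f (v l) = (2^-1 * G - omega)%:E)%E.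
  rewrite /energy -/u -/w -/gw.
  under eq_integral do rewrite EFinB EFinM.
  rewrite integralB //; last exact: integrableZl.
  by rewrite integralZl // GE omegaE.
pose eta := (4 * k)^-1.
have k0 : 0 < k by rewrite (lt_le_trans _ k1).
(* Young's inequality in the form eta w^2 + k - w = eta (w - 2 k)^2, where
   4 eta k = 1. *)
have omega_le : omega <= eta * W + k * V.
  have ik := integrable_cst_domain oOm OmM k.
  have iew : (@lebesgue_rV R d).-integrable Omega (fun x => (eta * w x ^+ 2)%:E).
    have -> : (fun x => (eta * w x ^+ 2)%:E) =
       (fun x => eta%:E * (EFin \o (fun x => (w x ^+ 2)%R)) x)%E by apply/funext.
    exact: integrableZl.
  have : (\int[@lebesgue_rV R d]_(x in Omega) (w x)%:E <=
      \int[@lebesgue_rV R d]_(x in Omega) ((eta * w x ^+ 2)%:E + k%:E))%E.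
    apply: le_integral => //; first exact: integrableD.
    move=> x _; rewrite -EFinD lee_fin -subr_ge0.
    have -> : eta * w x ^+ 2 + k - w x = eta * (w x - 2 * k) ^+ 2.
      by rewrite /eta; field; rewrite gt_eqF.
    by rewrite mulr_ge0 ?sqr_ge0 // invr_ge0 mulr_ge0 // ltW.
  have kV : (\int[@lebesgue_rV R d]_(x in Omega) k%:E = (k * V)%:E)%E.
    by rewrite EFinM -VE -integral_cst.
  have eW : (\int[@lebesgue_rV R d]_(x in Omega) (eta * w x ^+ 2)%:E = (eta * W)%:E)%E.
    by under eq_integral do rewrite EFinM; rewrite integralZl // WE.
  by rewrite integralD // kV eW omegaE -EFinD lee_fin.
have G0 : 0 <= G.
  by rewrite -lee_fin -GE; apply: integral_ge0 => x _; rewrite lee_fin sqr_ge0.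
(* eta W <= eta D U <= eta D CP G <= eta k G = G / 4. *)
have etaW : eta * W <= G / 4.
  have eta0 : 0 <= eta by rewrite invr_ge0 mulr_ge0 // ltW.
  apply: (@le_trans _ _ (eta * (k * G))).
    rewrite ler_wpM2l // (le_trans WDU) // (@le_trans _ _ (D * (CP * G))) ?ler_wpM2l //.
    by rewrite mulrA ler_wpM2r // /k lerDl.
  by rewrite le_eqVlt; apply/orP; left; apply/eqP; rewrite /eta; field; rewrite gt_eqF.
have GB : G <= B.
  have := energy_le l; rewrite E lee_fin /B; lra.
have -> : (H1norm Omega u = (powR (U + G) 2^-1)%:E)%E.
  rewrite /H1norm asboolT; last by exists gw.
  rewrite -poweR_EFin -/gw; congr (_ `^ _)%E.
  under eq_integral do rewrite EFinD.
  rewrite integralD //; last exact: (square_integrable_integrable oOm OmM su).2.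
  by rewrite UE GE.
rewrite lee_fin; apply: (@le_trans _ _ (powR ((1 + CP) * B) 2^-1)); last by rewrite lerDl.
apply: ge0_ler_powR; rewrite ?nnegrE ?invr_ge0 //.
- by rewrite addr_ge0.
- by rewrite mulr_ge0 // addr_ge0.
rewrite mulrDl mul1r addrC lerD // (le_trans UG) // -/CP ler_wpM2l //.
Qed.
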